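(* Let $K$ be a field with $\mathrm{char}(K)\neq 2,3$ and let $\mathcal{E}_1$ be an elliptic curve with Weierstrass form $y^2=x^3+bx$, where $b\in K$. Let $K_7=K(\mathcal{E}_1[7])$. Then $\mathrm{Gal}(K_7/K)$ is isomorphic to a subgroup of a semidirect product $Q_{16}\rtimes\mathbb{Z}/6\mathbb{Z}$. In particular, if $[K_7:K]=96$, then $\mathrm{Gal}(K_7/K)\simeq Q_{16}\rtimes\mathbb{Z}/6\mathbb{Z}$.
   Context: $Q_{16}$ denotes the generalized quaternion group of order $16$ (the dicyclic group of order 16). $K_7=K(\mathcal{E}_1[7])$ is the field generated over $K$ by the coordinates of the $7$-torsion points of $\mathcal{E}_1$. *)

(* Defs.v *)
From HB Require Import structures.
From mathcomp Require Import all_boot all_fingroup all_algebra all_solvable.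
From mathcomp Require Import boolp.

Set Implicit Arguments.
Unset Strict Implicit.
Unset Printing Implicit Defensive.

Import GRing.Theory.
Local Open Scope ring_scope.

(* The extension L / K is given by the morphism iota.                        *)
Section FieldExtensions.
Variables (K L : fieldType) (iota : {rmorphism K -> L}).

Definition ext_degree (n : nat) : Prop :=
  exists e : 'I_n -> L,
    forall x : L, exists! c : 'rV[K]_n, x = \sum_(i < n) iota (c 0 i) * e i.

(* Aut(L / K), a group under composition; it is Gal(L / K) when L / K is     *)
(* Galois. The library's 'Gal(_ / _) presupposes a finite normal ambient     *)
(* extension, which a field K(S) does not come with.                         *)
Record gal := Gal {
  gal_fun :> {rmorphism L -> L};
  gal_bij : bijective gal_fun;
  gal_fix : forall a : K, gal_fun (iota a) = iota a }.

HB.instance Definition _ := gen_eqMixin gal.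
HB.instance Definition _ := gen_choiceMixin gal.

Lemma galP (f g : gal) : f =1 g -> f = g.
Proof.
case: f g => [f f2 f3] [g g2 g3] /= fg.
have {}fg : f = g.
  case: f g fg {f2 f3 g2 g3} => f [[fD] [fM]] [g [[gD] [gM]]] /= /funext fg.
  case: _ / fg in gD gM *.
  by rewrite (Prop_irrelevance fD gD) (Prop_irrelevance fM gM).
by case: _ / fg in g2 g3 *; congr Gal; apply: Prop_irrelevance.
Qed.

Definition gal_one : gal :=
  @Gal idfun (Bijective (fun=> erefl) (fun=> erefl)) (fun=> erefl).

Fact gal_mul_fix (f g : gal) a : (f \o g) (iota a) = iota a.
Proof. by rewrite /= !gal_fix. Qed.

Definition gal_mul (f g : gal) : gal :=
  @Gal (f \o g : {rmorphism L -> L})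
    (bij_comp (gal_bij f) (gal_bij g)) (gal_mul_fix f g).

Fact gal_inv_ex (f : gal) : exists2 g : gal, cancel f g & cancel g f.
Proof.
have [g fK gK] := gal_bij f.
pose gA := GRing.isZmodMorphism.Build L L g (can2_zmod_morphism fK gK).
pose gM := GRing.isMonoidMorphism.Build L L g (can2_monoid_morphism fK gK).
pose h : {rmorphism L -> L} := HB.pack g gA gM.
have hbij : bijective h by exists f.
have hfix a : h (iota a) = iota a by rewrite -[in LHS](gal_fix f a); exact: fK.
by exists (Gal hbij hfix).
Qed.

Definition gal_inv (f : gal) : gal := sval (cid2 (gal_inv_ex f)).

Fact gal_mulA : associative gal_mul. Proof. by move=> f g h; apply: galP. Qed.
Fact gal_mul1 : left_id gal_one gal_mul. Proof. by move=> f; apply: galP. Qed.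
Fact gal_mulr1 : right_id gal_one gal_mul. Proof. by move=> f; apply: galP. Qed.
Fact gal_mulV : left_inverse gal_one gal_inv gal_mul.
Proof. by move=> f; apply: galP; rewrite /gal_inv; case: cid2. Qed.
Fact gal_mulrV : right_inverse gal_one gal_inv gal_mul.
Proof. by move=> f; apply: galP; rewrite /gal_inv; case: cid2. Qed.

HB.instance Definition _ :=
  isGroup.Build gal gal_mulA gal_mul1 gal_mulr1 gal_mulV gal_mulrV.

(* K(S), as the intersection of the subfields of L containing iota K and S.  *)
Variable S : L -> Prop.

Definition adjoin : {pred L} := fun x =>
  `[< forall F : {pred L}, divring_closed F ->
        (forall a, iota a \in F) -> (forall s, S s -> s \in F) -> x \in F >].

Fact adjoin_divring_closed : divring_closed adjoin.
Proof.
split=> [|x y /asboolP Ax /asboolP Ay|x y /asboolP Ax /asboolP Ay];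
  apply/asboolP=> F F_ring KF SF; have [F1 FB FV] := F_ring => //.
- by apply: FB; [apply: Ax|apply: Ay].
- by apply: FV; [apply: Ax|apply: Ay].
Qed.

HB.instance Definition _ :=
  GRing.isDivringClosed.Build L adjoin adjoin_divring_closed.

Record adjoin_field := AdjoinField {
  adjoin_val :> L;
  adjoin_valP : adjoin_val \in adjoin }.

HB.instance Definition _ := [isSub for adjoin_val].
HB.instance Definition _ := [Choice of adjoin_field by <:].
HB.instance Definition _ := [SubChoice_isSubIntegralDomain of adjoin_field by <:].
HB.instance Definition _ := [SubIntegralDomain_isSubField of adjoin_field by <:].

Fact adjoin_base a : iota a \in adjoin.
Proof. by apply/asboolP. Qed.

Definition adjoin_in (a : K) : adjoin_field := AdjoinField (adjoin_base a).

Fact adjoin_in_zmod_morphism : zmod_morphism adjoin_in.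
Proof. by move=> a b; apply: val_inj; rewrite /= rmorphB. Qed.

Fact adjoin_in_monoid_morphism : GRing.monoid_morphism adjoin_in.
Proof.
by split=> [|a b]; apply: val_inj; rewrite /= ?rmorph1 ?rmorphM.
Qed.

HB.instance Definition _ :=
  GRing.isZmodMorphism.Build K adjoin_field adjoin_in adjoin_in_zmod_morphism.
HB.instance Definition _ :=
  GRing.isMonoidMorphism.Build K adjoin_field adjoin_in
    adjoin_in_monoid_morphism.

End FieldExtensions.

Definition is_alg_closure (K : fieldType) (Kbar : closedFieldType)
    (iota : {rmorphism K -> Kbar}) : Prop :=
  forall x : Kbar, algebraicOver iota x.

(* The curve y^2 = x^3 + a x + b over a field of characteristic not 2, 3;    *)
(* None is the point at infinity.                                            *)
Section Weierstrass.
Variables (F : fieldType) (a b : F).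

Definition is_elliptic : bool := - 16%:R * (4%:R * a ^+ 3 + 27%:R * b ^+ 2) != 0.

Definition on_curve (P : option (F * F)) : bool :=
  if P is Some (x, y) then y ^+ 2 == x ^+ 3 + a * x + b else true.

Definition ec_add (P Q : option (F * F)) : option (F * F) :=
  match P, Q with
  | None, _ => Q
  | _, None => P
  | Some (x1, y1), Some (x2, y2) =>
    if (x1 == x2) && (y1 == - y2) then None else
    let l := if x1 == x2 then (3%:R * x1 ^+ 2 + a) / (2%:R * y1)
             else (y2 - y1) / (x2 - x1) in
    let x3 := l ^+ 2 - x1 - x2 in
    Some (x3, l * (x1 - x3) - y1)
  end.

Definition ec_muln (m : nat) (P : option (F * F)) : option (F * F) :=
  iter m (ec_add P) None.

Definition is_torsion (m : nat) (P : option (F * F)) : bool :=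
  on_curve P && (ec_muln m P == None).

Definition torsion_coord (m : nat) (c : F) : Prop :=
  exists x y : F, is_torsion m (Some (x, y)) /\ (c = x \/ c = y).

End Weierstrass.

(* K(E[m]) inside Kbar, for E : y^2 = x^3 + a x + b with a, b in K.          *)
Section TorsionField.
Variables (K Kbar : fieldType) (iota : {rmorphism K -> Kbar}) (a b : K).
Variable m : nat.

Definition torsion_field : fieldType :=
  adjoin_field iota (torsion_coord (iota a) (iota b) m).

Definition torsion_field_in : {rmorphism K -> torsion_field} :=
  adjoin_in iota (torsion_coord (iota a) (iota b) m).

End TorsionField.

Definition group_iso (A : groupType) (gT : finGroupType) (H : {group gT}) : Prop :=
  exists f : {multiplicative A -> gT},
    injective f /\ (forall y : gT, y \in H <-> exists x : A, f x = y).

Definition is_sdprod_Q16_Z6 (gT : finGroupType) (G : {group gT}) : Prop :=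
  exists Q C : {group gT},
    [/\ (Q ><| C = G)%g, (Q \isog 'Q_16)%g & (C \isog [set: 'Z_6])%g].

(* Main.v *)
Require Import Defs.
From HB Require Import structures.
From mathcomp Require Import all_boot all_fingroup all_algebra all_solvable.
From mathcomp Require Import boolp ring zify.

(* Over the closure, the points killed by 7 form a module over               *)
(* Z[i]/7 = F_49, with [i (x, y) = (- x, i y)], of dimension at most one      *)
(* since their abscissas are roots of a polynomial of degree 24. If it is     *)
(* zero then K_7 = K. Otherwise an automorphism of K_7 / K acts on it as a    *)
(* semilinear map x |-> g ^ c * x ^ (7 ^ u), u recording its effect on the    *)
(* square root of -1, and is determined by (c, u). These maps form a group of *)
(* order 96: the elements with 5 ^ c = (-1) ^ u (5 is the norm of g) form Q_16*)
(* and g ^ 16 together with the Frobenius generates a complement Z/6. Finally *)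
(* K_7 = K(P, i) for any nonzero P = (x, y) killed by 7, so that in degree 96 *)
(* the only relations between x, y and i are psi_7(x) = 0, the equation of    *)
(* the curve and i^2 = -1; hence all 96 maps come from automorphisms.         *)

(** The prime 7 is inert in Z[i], so a nonzero 7-torsion point P generates the 7-torsion over F_49
    ([gauss_transitive], from the count [torsion7_bound]), and an automorphism s is known from s(P)
    = (2 + i)^c P and from the sign in s(i) = i or - i. These data compose as in [semilin49] because
    (2 + i)^7 = 2 - i ([gauss7]). This gives the injective morphism of [torsion7_representation],
    whose target is identified by [semilin_sdprod]. Surjectivity in degree 96 ([acts_as_surj]) is a
    dimension count: by [ext_degree_span] the 96 monomials in x, y, i form a basis, and
    [specialisation] then extends any admissible change of (x, y, i) to an automorphism. *)

Set Implicit Arguments.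
Unset Strict Implicit.
Unset Printing Implicit Defensive.

Import GRing.Theory.
Local Open Scope ring_scope.

(** * The group law *)

Section AdditionFormulas.
Variables (F : fieldType) (a b : F).
Implicit Types (x y l : F) (P Q R S : option (F * F)).

Local Notation oncurve := (on_curve a b).
Local Notation "P +e Q" := (ec_add a P Q) (at level 50, left associativity).

Definition ec_opp P : option (F * F) := omap (fun p => (p.1, - p.2)) P.

Lemma ec_oppK : involutive ec_opp.
Proof. by case=> [[x y]|] //=; rewrite opprK. Qed.

Lemma ec_opp_curve P : oncurve P -> oncurve (ec_opp P).
Proof. by case: P => [[x y]|] //=; rewrite sqrrN. Qed.

Lemma ec_add0 P : P +e None = P.
Proof. by case: P => [[]|]. Qed.

Lemma ec_addN P : P +e ec_opp P = None.
Proof. by case: P => [[x y]|] //=; rewrite opprK !eqxx. Qed.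

Lemma ec_add_chord x1 y1 x2 y2 : x1 != x2 ->
  let l := (y2 - y1) / (x2 - x1) in let x3 := l ^+ 2 - x1 - x2 in
  Some (x1, y1) +e Some (x2, y2) = Some (x3, l * (x1 - x3) - y1).
Proof. by move=> /negPf x12 /=; rewrite x12. Qed.

Lemma same_x_curve x y1 y2 : oncurve (Some (x, y1)) -> oncurve (Some (x, y2)) ->
  y1 = y2 \/ y1 = - y2.
Proof.
move=> /eqP E1 /eqP E2; have : y1 ^+ 2 == y2 ^+ 2 by rewrite E1 E2.
by rewrite eqf_sqr => /orP[] /eqP; [left | right].
Qed.

Lemma ec_x_neq x1 y1 x2 y2 :
  oncurve (Some (x1, y1)) -> oncurve (Some (x2, y2)) ->
  Some (x1, y1) <> Some (x2, y2) -> Some (x1, y1) <> ec_opp (Some (x2, y2)) ->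
  x1 != x2.
Proof.
move=> c1 c2 n1 n2; apply/eqP => x12; rewrite {x1}x12 in c1 n1 n2 *.
by case: (same_x_curve c1 c2) => y12; [apply: n1 | apply: n2]; rewrite /= y12.
Qed.

Hypothesis two : 2%:R != 0 :> F.

(* This pair of equations characterises the slope of the chord through the   *)
(* two points and, when they coincide, that of the tangent.                  *)
Definition is_slope x1 y1 x2 y2 l :=
  y1 - y2 = l * (x1 - x2) /\ l * (y1 + y2) = x1 ^+ 2 + x1 * x2 + x2 ^+ 2 + a.

Lemma slope_ex x1 y1 x2 y2 :
  oncurve (Some (x1, y1)) -> oncurve (Some (x2, y2)) ->
  Some (x2, y2) <> ec_opp (Some (x1, y1)) -> exists l, is_slope x1 y1 x2 y2 l.
Proof.
move=> c1 c2 n12; move/eqP: (c1) => E1; move/eqP: (c2) => E2.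
case: (eqVneq x1 x2) => [x12|x12].
  move: c1 n12 E1; rewrite x12 => c1 n12 E1.
  have y12 : y1 = y2.
    by case: (same_x_curve c1 c2) => // y12; case: n12; rewrite /= y12 opprK.
  have yn0 : y2 != 0.
    by apply/eqP => y20; apply: n12; rewrite /= y12 y20 oppr0.
  exists ((3%:R * x2 ^+ 2 + a) / (2%:R * y2)); split;
    rewrite ?y12; first by ring.
  by field; rewrite yn0 two.
have n0 : x1 - x2 != 0 by rewrite subr_eq0.
exists ((y1 - y2) / (x1 - x2)); split; first by rewrite divfK.
(* The second slope equation is the difference of the two curve equations divided by [x1 - x2]. *)
have := congr1 (fun z => z / (x1 - x2)) (congr2 (fun u v => u - v) E1 E2).
have -> : (y1 ^+ 2 - y2 ^+ 2) / (x1 - x2)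
          = (y1 - y2) / (x1 - x2) * (y1 + y2) by field.
by move=> ->; field.
Qed.

Lemma ec_addE x1 y1 x2 y2 l : is_slope x1 y1 x2 y2 l ->
  Some (x2, y2) <> ec_opp (Some (x1, y1)) ->
  let x3 := l ^+ 2 - x1 - x2 in
  Some (x1, y1) +e Some (x2, y2) = Some (x3, l * (x1 - x3) - y1).
Proof.
move=> [E1 E2] n12; rewrite /ec_add.
case: (eqVneq x1 x2) => [x12|x12] /=.
  have y12 : y1 = y2 by apply/eqP; rewrite -subr_eq0 E1 x12 subrr mulr0.
  rewrite y12 x12 in n12 E2 *.
  have yn0 : y2 != 0 by apply/eqP => y20; apply: n12; rewrite /= y20 oppr0.
  case: eqP => [y2N|_]; first by case: n12; rewrite /= -y2N.
  have -> // : (3%:R * x2 ^+ 2 + a) / (2%:R * y2) = l.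
  apply: (canLR (mulfK _)); first by rewrite mulf_neq0.
  by transitivity (l * (y2 + y2)); [rewrite E2 | ]; ring.
have n0 : x2 - x1 != 0 by rewrite subr_eq0 eq_sym.
have -> // : (y2 - y1) / (x2 - x1) = l.
apply: (canLR (mulfK n0)); transitivity (- (y1 - y2)); first by ring.
by rewrite E1; ring.
Qed.

Lemma slope_sym x1 y1 x2 y2 l :
  is_slope x1 y1 x2 y2 l -> is_slope x2 y2 x1 y1 l.
Proof.
move=> [E1 E2]; split; last by rewrite [y2 + _]addrC E2; ring.
by rewrite -[LHS]opprB E1; ring.
Qed.

Lemma eq_ec_opp P Q : P = ec_opp Q -> Q = ec_opp P.
Proof. by move->; rewrite ec_oppK. Qed.

Variant add_spec P Q : option (F * F) -> Type :=
| AddP0 of P = None : add_spec P Q Q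
| Add0Q of Q = None : add_spec P Q P
| AddN of Q = ec_opp P : add_spec P Q None
| AddSlope x1 y1 x2 y2 l of P = Some (x1, y1) & Q = Some (x2, y2) &
    Q <> ec_opp P & is_slope x1 y1 x2 y2 l :
    add_spec P Q (Some (l ^+ 2 - x1 - x2, l * (x1 - (l ^+ 2 - x1 - x2)) - y1)).

Lemma ec_addP P Q : oncurve P -> oncurve Q -> add_spec P Q (P +e Q).
Proof.
case: P Q => [[x1 y1]|] [[x2 y2]|] c1 c2; try by [constructor].
have [Qe|Qn] := pselect (Some (x2, y2) = ec_opp (Some (x1, y1))).
  by rewrite Qe ec_addN; constructor.
have [l sl] := cid (slope_ex c1 c2 Qn).
by rewrite (ec_addE sl Qn); apply: AddSlope.
Qed.

Lemma ec_addC P Q : oncurve P -> oncurve Q -> P +e Q = Q +e P.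
Proof.
move=> cP cQ; case: (ec_addP cP cQ).
- by move->; rewrite ec_add0.
- by move->.
- by move->; rewrite -{2}[P]ec_oppK ec_addN.
move=> x1 y1 x2 y2 l -> -> n12 sl; have [E1 _] := sl.
rewrite (ec_addE (slope_sym sl)); last by move/eq_ec_opp.
congr (Some (_, _)); first by ring.
have -> : y1 = y2 + l * (x1 - x2) by rewrite -E1; ring.
by ring.
Qed.

Lemma ec_add_curve P Q : oncurve P -> oncurve Q -> oncurve (P +e Q).
Proof.
move=> cP cQ; case: (ec_addP cP cQ) => // x1 y1 x2 y2 l _ Qe _ [E1 E2].
move: cQ; rewrite Qe => /eqP cQ /=; apply/eqP.
have y1E : y1 = y2 + l * (x1 - x2) by rewrite -E1; ring.
have -> : b = y2 ^+ 2 - x2 ^+ 3 - a * x2 by rewrite cQ; ring.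
have -> : a = l * (y1 + y2) - (x1 ^+ 2 + x1 * x2 + x2 ^+ 2) by rewrite E2; ring.
by rewrite y1E; ring.
Qed.

(* Generic associativity. Eliminating [a] and [b], and then [y2], from the   *)
(* equations for the two slopes leaves an identity of rational functions in  *)
(* free variables.                                                           *)
Lemma ec_assoc_slopes x1 y1 x2 y2 x3 y3 l n :
  is_slope x1 y1 x2 y2 l -> is_slope x3 y3 x2 y2 n ->
  let x4 := l ^+ 2 - x1 - x2 in let y4 := l * (x1 - x4) - y1 in
  let x6 := n ^+ 2 - x2 - x3 in let y6 := n * (x2 - x6) - y2 in
  x3 != x1 -> x4 != x3 -> x1 != x6 ->
  Some (x4, y4) +e Some (x3, y3) = Some (x1, y1) +e Some (x6, y6).
Proof.
move=> [E1 E2] [E3 E4] x4 y4 x6 y6 x31 x43 x16.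
have y1E : y1 = y2 + l * (x1 - x2) by rewrite -E1; ring.
have y3E : y3 = y2 + n * (x3 - x2) by rewrite -E3; ring.
have key : 2%:R * (n - l) * y2 =
    x3 ^+ 2 + x3 * x2 - n ^+ 2 * (x3 - x2)
    - (x1 ^+ 2 + x1 * x2 - l ^+ 2 * (x1 - x2)).
  have -> : 2%:R * (n - l) * y2 =
      n * (y3 + y2) - n ^+ 2 * (x3 - x2)
      - (l * (y1 + y2) - l ^+ 2 * (x1 - x2)) by rewrite y1E y3E; ring.
  by rewrite E4 E2; ring.
(* With equal slopes the three points would be collinear, forcing [x3] to be [x1] or [x4]. *)
have nl : n - l != 0.
  apply/eqP => /eqP; rewrite subr_eq0 => /eqP nl.
  have : (x3 - x1) * (x4 - x3) = 0.
    have -> : (x3 - x1) * (x4 - x3) = 2%:R * (n - l) * y2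
       - (x3 ^+ 2 + x3 * x2 - n ^+ 2 * (x3 - x2)
          - (x1 ^+ 2 + x1 * x2 - l ^+ 2 * (x1 - x2))).
      by rewrite /x4 nl; ring.
    by rewrite key subrr.
  by move/eqP; rewrite mulf_eq0 !subr_eq0 (negPf x31) (negPf x43).
have y2E : y2 = (x3 ^+ 2 + x3 * x2 - n ^+ 2 * (x3 - x2)
    - (x1 ^+ 2 + x1 * x2 - l ^+ 2 * (x1 - x2))) / (2%:R * (n - l)).
  by rewrite -key [2%:R * (n - l) * y2]mulrC mulfK // mulf_neq0.
have d1 : x3 - x4 != 0 by rewrite subr_eq0 eq_sym.
have d2 : x6 - x1 != 0 by rewrite subr_eq0 eq_sym.
rewrite !ec_add_chord // /y4 /y6 y3E y1E y2E; rewrite /x4 /x6 in d1 d2 *.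
by congr (Some (_, _)); field; rewrite d1 d2 nl two.
Qed.

Hypothesis disc : 4%:R * a ^+ 3 + 27%:R * b ^+ 2 != 0.

(** Otherwise [x] would be a double root of the cubic, against [disc]. *)
Lemma nonsingular x : oncurve (Some (x, 0)) -> 3%:R * x ^+ 2 + a != 0.
Proof.
move=> /eqP c; apply: contra disc => /eqP s.
have aE : a = - (3%:R * x ^+ 2) by apply/eqP; rewrite -addr_eq0 addrC s.
have -> : b = - x ^+ 3 - a * x.
  transitivity (0 ^+ 2 - x ^+ 3 - a * x); last by ring.
  by rewrite c; ring.
by rewrite aE; apply/eqP; ring.
Qed.

(** The reflection of the line through P and Q has slope [- l], passes through P + Q and - Q, and
    meets the curve again at - P. *)
Lemma ec_addK P Q : oncurve P -> oncurve Q -> (P +e Q) +e ec_opp Q = P.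
Proof.
move=> cP cQ; case: (ec_addP cP cQ).
- by move->; rewrite ec_addN.
- by move->; rewrite ec_add0.
- by move->; rewrite ec_oppK.
move=> x1 y1 x2 y2 l Pe Qe n12 [E1 E2]; rewrite {}Pe {}Qe in cP cQ n12 *.
have y1E : y1 = y2 + l * (x1 - x2) by rewrite -E1; ring.
have aE : a = l * (y1 + y2) - (x1 ^+ 2 + x1 * x2 + x2 ^+ 2).
  by rewrite E2; ring.
set x4 := l ^+ 2 - x1 - x2; set y4 := l * (x1 - x4) - y1.
rewrite [ec_opp _]/=.
have sl : is_slope x4 y4 x2 (- y2) (- l).
  by split; rewrite ?aE /y4 y1E /x4; ring.
rewrite (ec_addE sl); first by rewrite /y4 y1E /x4; congr (Some (_, _)); ring.
(* The remaining case is P + Q = Q: the line, which is not vertical, passes through Q and - Q, so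
   [y2 = 0], and the derivative of the cubic vanishes at [x2]. *)
move=> /= [x24 /oppr_inj y24].
have y20 : y2 = 0.
  apply/eqP; have : 2%:R * y2 == 0; last by rewrite mulf_eq0 (negPf two).
  apply/eqP; transitivity (y2 + y4); first by rewrite -y24; ring.
  by rewrite /y4 -x24 y1E; ring.
have := cQ; rewrite y20 => /nonsingular/eqP[]; rewrite aE y1E y20.
transitivity ((x2 - x4) * (x2 - x1)); first by rewrite /x4; ring.
by rewrite x24 subrr mul0r.
Qed.

Lemma ec_add_eq P Q R : oncurve P -> oncurve Q -> P +e Q = R ->
  Q = R +e ec_opp P.
Proof. by move=> cP cQ <-; rewrite (ec_addC cP cQ) ec_addK. Qed.

(** The third points S that could make an addition degenerate; the last two entries are those with Q
    + S = P and Q + S = - P. *)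
Definition assoc_bad P Q : seq (option (F * F)) :=
  [:: None; P; ec_opp P; Q; ec_opp Q; P +e Q; ec_opp (P +e Q);
      P +e ec_opp Q; ec_opp P +e ec_opp Q].

Lemma ec_assoc_generic P Q S : oncurve P -> oncurve Q -> oncurve S ->
  S \notin assoc_bad P Q -> (P +e Q) +e S = P +e (Q +e S).
Proof.
move=> cP cQ cS; rewrite !inE !negb_or.
case/and5P=> [/eqP S0 /eqP SP /eqP SNP /eqP SQ].
case/and5P=> /eqP SNQ /eqP SR /eqP SNR /eqP U1 /eqP U2.
have cNP := ec_opp_curve cP; have cNQ := ec_opp_curve cQ.
case: (ec_addP cP cQ) (ec_add_curve cP cQ) SR SNR.
- by move->.
- by move->.
- move=> Qe _ _ _; rewrite Qe (ec_addC cNP cS).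
  rewrite (ec_addC cP (ec_add_curve cS cNP)).
  by have := ec_addK cS cNP; rewrite ec_oppK => ->.
move=> x1 y1 x2 y2 l Pe Qe n12 sl cR SR SNR.
case: S => [[x3 y3]|] // in cS S0 SP SNP SQ SNQ SR SNR U1 U2 *.
have nQS : Some (x3, y3) <> ec_opp (Some (x2, y2)) by rewrite -Qe.
rewrite {}Pe {}Qe in cP cQ cNP cNQ n12 SP SNP SQ SNQ U1 U2 *.
have [n sn] := slope_ex cQ cS nQS.
have UE := ec_addE sn nQS; have cU := ec_add_curve cQ cS.
have U1' : Some (x2, y2) +e Some (x3, y3) <> Some (x1, y1).
  by move/(ec_add_eq cQ cS).
have U2' : Some (x2, y2) +e Some (x3, y3) <> ec_opp (Some (x1, y1)).
  by move/(ec_add_eq cQ cS).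
cbv zeta in UE; rewrite UE in cU U1' U2' *.
apply: ec_assoc_slopes => //; first exact: slope_sym.
- exact: ec_x_neq SP SNP.
- by rewrite eq_sym; apply: ec_x_neq SR SNR.
- by rewrite eq_sym; apply: ec_x_neq U1' U2'.
Qed.

End AdditionFormulas.

Lemma ec_elliptic (F : fieldType) (a b : F) : is_elliptic a b ->
  2%:R != 0 :> F /\ 4%:R * a ^+ 3 + 27%:R * b ^+ 2 != 0.
Proof.
rewrite /is_elliptic mulf_eq0 negb_or oppr_eq0 => /andP[h ->]; split=> //.
by apply: contra h => /eqP h; rewrite (natrM F 2 8) h mul0r.
Qed.

(* The addition is a group law only on a nonsingular curve, hence the        *)
(* phantom argument.                                                         *)
Definition ec_points (F : fieldType) (a b : F) of is_elliptic a b : Type :=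
  {P : option (F * F) | on_curve a b P}.

HB.instance Definition _ (F : fieldType) (a b : F) (ell : is_elliptic a b) :=
  SubChoice.on (ec_points ell).

Section GroupLaw.
Variables (F : closedFieldType) (a b : F) (ell : is_elliptic a b).

Let two : 2%:R != 0 :> F := (ec_elliptic ell).1.
Let disc := (ec_elliptic ell).2.
Local Notation "P +e Q" := (ec_add a P Q) (at level 50, left associativity).

(** Over a closed field every abscissa carries a point, and only finitely many abscissas occur in
    [s]. *)
Lemma ec_avoid (s : seq (option (F * F))) :
  exists2 S, on_curve a b S & S \notin s.
Proof.
pose xs := pmap (omap fst) s.
have /closed_nonrootP[x] : \prod_(x <- xs) ('X - x%:P) != 0 :> {poly F}.
  by rewrite monic_neq0 // monic_prod_XsubC.
rewrite root_prod_XsubC => xn.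
have /closed_rootP[y] : size ('X^2 - (x ^+ 3 + a * x + b)%:P) != 1.
  by rewrite size_polyDl size_polyXn // size_polyN size_polyC; case: (_ != 0).
rewrite /root !hornerE subr_eq0 => yE.
exists (Some (x, y)) => //; apply: contra xn => /(map_f (omap fst)) /= xy.
by rewrite mem_pmap.
Qed.

(* The two sides agree after the addition of a point [S] in general position,*)
(* to which the generic case applies four times.                             *)
Lemma ec_assoc P Q R : on_curve a b P -> on_curve a b Q -> on_curve a b R ->
  P +e (Q +e R) = (P +e Q) +e R.
Proof.
move=> cP cQ cR.
have cPQ := ec_add_curve two cP cQ; have cQR := ec_add_curve two cQ cR.
(* The last list keeps [R + S], rather than [S], out of the bad points for P and Q. *)
have [S cS] := ec_avoid (assoc_bad a (P +e Q) R ++ assoc_bad a Q R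
  ++ assoc_bad a P (Q +e R) ++ [seq X +e ec_opp R | X <- assoc_bad a P Q]).
rewrite mem_cat negb_or => /andP[S1]; rewrite mem_cat negb_or => /andP[S2].
rewrite mem_cat negb_or => /andP[S3 S4].
have cRS := ec_add_curve two cR cS.
have E : P +e (Q +e R) +e S = P +e Q +e R +e S.
  rewrite (ec_assoc_generic two disc cP cQR cS S3).
  rewrite (ec_assoc_generic two disc cQ cR cS S2).
  rewrite (ec_assoc_generic two disc cPQ cR cS S1).
  rewrite (ec_assoc_generic two disc cP cQ cRS) //.
  apply: contra S4 => RS; apply/mapP; exists (R +e S) => //.
  exact: (ec_add_eq two disc cR cS).
rewrite -(ec_addK two disc (ec_add_curve two cP cQR) cS) E.
by rewrite (ec_addK two disc (ec_add_curve two cPQ cR) cS).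
Qed.

Local Notation points := (ec_points ell).

Definition points_zero : points := Sub None isT.
Definition points_opp (P : points) : points :=
  Sub (ec_opp (val P)) (ec_opp_curve (valP P)).
Definition points_add (P Q : points) : points :=
  Sub (val P +e val Q) (ec_add_curve two (valP P) (valP Q)).

Fact points_addA : associative points_add.
Proof. by move=> P Q R; apply/val_inj/ec_assoc; exact: valP. Qed.
Fact points_addC : commutative points_add.
Proof. by move=> P Q; apply/val_inj/(ec_addC two (valP P) (valP Q)). Qed.
Fact points_add0 : left_id points_zero points_add.
Proof. by move=> P; apply: val_inj. Qed.
Fact points_addN : left_inverse points_zero points_opp points_add.
Proof.
by move=> P; rewrite points_addC; apply: val_inj; exact: ec_addN.
Qed.

HB.instance Definition _ := GRing.isZmodule.Build points
  points_addA points_addC points_add0 points_addN.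

Lemma val_pointsD (P Q : points) : val (P + Q) = val P +e val Q.
Proof. by []. Qed.

Lemma val_pointsN (P : points) : val (- P) = ec_opp (val P).
Proof. by []. Qed.

Lemma val_pointsMn (P : points) n : val (P *+ n) = ec_muln a n (val P).
Proof. by elim: n => [|n IHn] //; rewrite mulrS val_pointsD IHn. Qed.

End GroupLaw.

(** * Seven-torsion as a module over the Gaussian integers *)

Section GaussianModule.
Variables (V : zmodType) (J : {additive V -> V}).
Hypothesis JJ : forall v, J (J v) = - v.

(* Multiplication by [2 + J], a generator of the unit group of [F_7[J]].     *)
Definition gauss (v : V) := v *+ 2 + J v.
Definition gauss_conj (v : V) := v *+ 2 - J v.

Lemma iter_gauss0 n : iter n gauss 0 = 0.
Proof. by elim: n => //= n ->; rewrite /gauss raddf0 mul0rn addr0. Qed.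

Section Torsion.
Variable v : V.
Hypothesis v7 : v *+ 7 = 0.

Let lin (p : nat * nat) := v *+ p.1 + J v *+ p.2.

Let J7 : J v *+ 7 = 0. Proof. by rewrite -raddfMn v7 raddf0. Qed.

Lemma mulrn_mod7 (w : V) m : w *+ 7 = 0 -> w *+ m = w *+ (m %% 7).
Proof.
move=> w7; rewrite {1}(divn_eq m 7) mulrnDr mulnC mulrnA w7.
by rewrite mul0rn add0r.
Qed.

Let opp7 : - v = v *+ 6.
Proof. by apply/eqP; rewrite eq_sym -addr_eq0 -mulrSr v7. Qed.

Let gauss_lin p :
  gauss (lin p) = lin ((2 * p.1 + 6 * p.2) %% 7, (2 * p.2 + p.1) %% 7)%N.
Proof.
rewrite /gauss /lin raddfD !raddfMn JJ mulrnDl -!mulrnA /=.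
rewrite -(mulrn_mod7 _ v7) -(mulrn_mod7 _ J7) opp7 -mulrnA.
rewrite (mulrnDr v (2 * p.1) (6 * p.2)) (mulrnDr (J v) (2 * p.2) p.1).
by rewrite (mulnC p.1) (mulnC p.2) [J v *+ _ + v *+ _]addrC addrACA.
Qed.

Let iter_gauss n : iter n gauss v =
  lin (iter n (fun p =>
    ((2 * p.1 + 6 * p.2) %% 7, (2 * p.2 + p.1) %% 7)) (1, 0))%N.
Proof. by elim: n => [|n IHn]; rewrite ?/lin /= ?addr0 // IHn gauss_lin. Qed.

(** In F_49 the seventh power is the Frobenius, that is, conjugation. *)
Lemma gauss7 : iter 7 gauss v = gauss_conj v.
Proof.
rewrite iter_gauss /gauss_conj /lin; congr (_ + _); apply/eqP.
by rewrite eq_sym eqr_oppLR -addr_eq0 -mulrS J7.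
Qed.

(** The exponents 16 and 24 are 48 / 3 and 48 / 2; as 4 and -1 differ from 1 modulo 7, the order of
    2 + J is exactly 48. *)
Lemma gauss16 : iter 16 gauss v = v *+ 4.
Proof. by rewrite iter_gauss /lin addr0. Qed.

Lemma gauss24 : iter 24 gauss v = - v.
Proof. by rewrite iter_gauss opp7 /lin addr0. Qed.

Lemma gauss48 : iter 48 gauss v = v.
Proof. by rewrite iter_gauss /lin addr0. Qed.

Lemma iter_gauss_torsion n : iter n gauss v *+ 7 = 0.
Proof.
by rewrite iter_gauss /lin mulrnDl mulrnAC v7 mulrnAC J7 !mul0rn addr0.
Qed.

Lemma gauss_mod n : iter n gauss v = iter (n %% 48) gauss v.
Proof.
rewrite {1}(divn_eq n 48) addnC iterD; congr (iter _ _ _).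
by elim: (n %/ 48)%N => [|m IHm] //; rewrite mulSn iterD IHm gauss48.
Qed.

Hypothesis v0 : v <> 0.

Lemma mulrn_neq0 k : ~~ (7 %| k)%N -> v *+ k <> 0.
Proof.
move=> k7 vk; apply: v0.
have kg : (0 < k)%N by case: k k7 {vk}.
have : v *+ gcdn k 7 = 0.
  case: (egcdnP 7 kg) => u w E _; have := congr1 (GRing.natmul v) E.
  by rewrite mulrnDr !(mulnC _ k) !(mulnC _ 7) !mulrnA vk v7 !mul0rn add0r.
suff -> : gcdn k 7 = 1%N by [].
by apply/eqP; rewrite -/(coprime k 7) coprime_sym prime_coprime.
Qed.

Lemma iter_gauss_neq0 n : iter n gauss v <> 0.
Proof.
move=> n0; apply: v0; have <- : iter (47 * n + n) gauss v = v.
  by rewrite -mulSnr gauss_mod modnMr.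
by rewrite iterD n0 iter_gauss0.
Qed.

Lemma gauss_free k : (0 < k < 48)%N -> iter k gauss v <> v.
Proof.
move=> k48 kv.
have kjv j : iter (k * j %% 48) gauss v = v.
  rewrite -gauss_mod; elim: j => [|j IHj]; first by rewrite muln0.
  by rewrite mulnS iterD IHj kv.
(* A nontrivial subgroup of Z/48 contains 24, of order 2, or 16, of order 3. *)
have /hasP[j _] : has (fun j => k * j %% 48 \in [:: 16; 24])%N (iota 0 48).
  have: k \in iota 1 47 by rewrite mem_iota.
  by move: k {k48 kv kjv}; apply/allP; vm_compute.
rewrite !inE => /orP[]/eqP kj; have := kjv j; rewrite kj.
  rewrite gauss16 mulrSr => /(canRL (addrK _)); rewrite subrr.
  exact: mulrn_neq0.
rewrite gauss24 => /eqP; rewrite eq_sym -addr_eq0 -mulr2n => /eqP.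
exact: mulrn_neq0.
Qed.

Lemma gauss_inj j k : (j < 48)%N -> (k < 48)%N ->
  iter j gauss v = iter k gauss v -> j = k.
Proof.
wlog jk : j k / (j <= k)%N => [IH|] j48 k48.
  by case/orP: (leq_total j k) => /IH; [|move=> H /esym /H ->]; auto.
move=> E; apply/eqP; rewrite eqn_leq jk leqNgt; apply/negP => lt_jk.
have d48 : (0 < 48 - k + j < 48)%N by lia.
apply: (gauss_free d48); rewrite iterD E -iterD subnK ?gauss48 //.
exact: ltnW.
Qed.

Hypothesis bound : forall s : seq V,
  uniq s -> (forall w, w \in s -> w <> 0 /\ w *+ 7 = 0) -> (size s <= 48)%N.

(** The powers of 2 + J already yield 48 elements from [v], so [bound] leaves no room for
    another. *)
Lemma gauss_transitive w : w <> 0 -> w *+ 7 = 0 ->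
  exists2 k, (k < 48)%N & w = iter k gauss v.
Proof.
move=> w0 w7; pose s := mkseq (fun k => iter k gauss v) 48.
have [/mapP[k]|ws] := boolP (w \in s).
  by rewrite mem_iota => k48 ->; exists k.
suff : (size (w :: s) <= 48)%N by [].
apply: bound => [|u].
  rewrite cons_uniq ws; apply/mkseq_uniqP => j k j48 k48.
  exact: gauss_inj.
rewrite inE => /predU1P[-> //|/mapP[k _ ->]]; split.
  exact: iter_gauss_neq0.
exact: iter_gauss_torsion.
Qed.
End Torsion.
End GaussianModule.

(** * The 7-division polynomial of [y^2 = x^3 + b x] *)

(* All coefficients but the constant one are divisible by 7: the curve is    *)
(* supersingular in characteristic 7.                                        *)
Definition psi7 (R : nzRingType) (b : R) : {poly R} := Poly
  [:: - b ^+ 12; 0; 7%:R * 28%:R * b ^+ 11; 0; 7%:R * 186%:R * b ^+ 10; 0;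
      7%:R * 2108%:R * b ^+ 9; 0; 7%:R * 2239%:R * b ^+ 8; 0;
      - (7%:R * 24%:R * 251%:R) * b ^+ 7; 0;
      - (7%:R * 28%:R * 571%:R) * b ^+ 6; 0;
      - (7%:R * 104%:R * 113%:R) * b ^+ 5; 0;
      - (7%:R * 7%:R * 719%:R) * b ^+ 4; 0;
      - (7%:R * 4%:R * 709%:R) * b ^+ 3; 0; - (7%:R * 422%:R) * b ^+ 2; 0;
      7%:R * 44%:R * b; 0; 7%:R].

Lemma map_psi7 (R S : nzRingType) (f : {rmorphism R -> S}) (b : R) :
  map_poly f (psi7 b) = psi7 (f b).
Proof.
rewrite map_Poly_id0 ?rmorph0 //; congr Poly; rewrite /=.
by rewrite ?(rmorphN, rmorphM, rmorphXn, rmorph_nat, rmorph0).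
Qed.

Lemma size_psi7 (R : nzRingType) (b : R) : 7%:R != 0 :> R -> size (psi7 b) = 25.
Proof. by move=> h; rewrite (@PolyK _ 0). Qed.

(** With [psi7_torsion], this excludes characteristic 7 as soon as there is a nonzero 7-torsion
    point, since b is nonzero. *)
Lemma psi7_char7 (R : comNzRingType) (b x : R) :
  7%:R = 0 :> R -> (psi7 b).[x] = - b ^+ 12.
Proof. by move=> h; rewrite horner_Poly /= h; ring. Qed.

Section DivisionPolynomial.
Variables (F : closedFieldType) (b : F) (ell : is_elliptic b 0).
Local Notation points := (ec_points ell).

Let two : 2%:R != 0 :> F := (ec_elliptic ell).1.

Lemma elliptic_neq0 : b != 0.
Proof.
apply: contra (ec_elliptic ell).2 => /eqP ->.
by rewrite !expr0n !mulr0 addr0.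
Qed.

(** From 7 P = 0 one gets 4 P = - 3 P, so 4 P and 3 P have the same abscissa; clearing denominators
    in this equality gives [psi7]. *)
Lemma psi7_torsion (P : points) x y :
  val P = Some (x, y) -> P *+ 7 = 0 -> root (psi7 b) x.
Proof.
move=> PE P7; have cP : on_curve b 0 (Some (x, y)) by rewrite -PE (valP P).
have P0 : P <> 0 by move=> P0; move: PE; rewrite P0.
have nz k : ~~ (7 %| k)%N -> P *+ k <> 0 by exact: mulrn_neq0.
have yE : y ^+ 2 = x ^+ 3 + b * x by move/eqP: cP; rewrite addr0.
have y0 : y != 0.
  apply/eqP => y0; apply: (nz 2) => //; apply: val_inj.
  by rewrite mulr2n val_pointsD PE y0 /= oppr0 !eqxx.
(* [(x2, y2)] is 2 P by the duplication formula. The 4-division polynomial is 4 y [h], and [p3]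
   below is the 3-division polynomial. *)
pose x2 := (x ^+ 2 - b) ^+ 2 / (4%:R * y ^+ 2).
pose h := x ^+ 6 + 5%:R * b * x ^+ 4 - 5%:R * b ^+ 2 * x ^+ 2 - b ^+ 3.
pose y2 := h / (8%:R * y ^+ 2 * y).
have four : 4%:R != 0 :> F by rewrite (natrM _ 2 2) mulf_neq0.
have eight : 8%:R != 0 :> F by rewrite (natrM _ 2 4) mulf_neq0.
have q0 : x ^+ 3 + b * x != 0 by rewrite -yE expf_neq0.
have E2 : val (P *+ 2) = Some (x2, y2).
  rewrite mulr2n val_pointsD PE.
  rewrite (@ec_addE _ b two x y x y ((3%:R * x ^+ 2 + b) / (2%:R * y))).
  - have X : ((3%:R * x ^+ 2 + b) / (2%:R * y)) ^+ 2 - x - x = x2.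
      rewrite /x2 exprMn exprVn exprMn yE; field.
      by rewrite four q0.
    rewrite X; congr (Some (_, _)).
    rewrite /x2 /y2 /h yE; apply/eqP; rewrite -subr_eq0; apply/eqP.
    transitivity ((x ^+ 3 + b * x - y ^+ 2) / y).
      by field; rewrite y0 q0 eight four two.
    by rewrite yE subrr mul0r.
  - by split; [ring | field; rewrite two y0].
  - move=> /= [/eqP]; rewrite -addr_eq0 -mulr2n -mulr_natl mulf_eq0.
    by rewrite (negPf two) (negPf y0).
have P4 : P *+ 4 = P *+ 2 + P *+ 2 by rewrite -mulrnDr.
have y20 : y2 != 0.
  apply/eqP => y20; apply: (nz 4) => //; apply: val_inj.
  by rewrite P4 val_pointsD E2 y20 /= oppr0 !eqxx.
have cP2 : on_curve b 0 (Some (x2, y2)) by rewrite -E2 (valP (P *+ 2)).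
have x20 : x != x2.
  apply: (ec_x_neq cP cP2); rewrite -PE -E2 -?val_pointsN => /val_inj PP.
    apply: P0; move/eqP: PP; rewrite eq_sym mulr2n -subr_eq0 addrK.
    by move/eqP.
  by apply: (nz 3) => //; rewrite mulrS [X in X + _]PP addNr.
have E3 : exists y3, val (P *+ 3) =
    Some (((y2 - y) / (x2 - x)) ^+ 2 - x - x2, y3).
  by rewrite mulrS val_pointsD PE E2 ec_add_chord //; eexists.
have E4 : exists y4, val (P *+ 4) =
    Some (((3%:R * x2 ^+ 2 + b) / (2%:R * y2)) ^+ 2 - x2 - x2, y4).
  rewrite P4 val_pointsD E2.
  rewrite (@ec_addE _ b two x2 y2 x2 y2 ((3%:R * x2 ^+ 2 + b) / (2%:R * y2))).
  - by eexists.
  - by split; [ring | field; rewrite two y20].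
  - move=> /= [/eqP]; rewrite -addr_eq0 -mulr2n -mulr_natl mulf_eq0.
    by rewrite (negPf two) (negPf y20).
have [y3 {}E3] := E3; have [y4 {}E4] := E4.
have : P *+ 4 = - (P *+ 3) by apply/eqP; rewrite -addr_eq0 -mulrnDr P7.
move/(congr1 val); rewrite val_pointsN E3 E4 /= => -[E _].
move/eqP: E; rewrite -subr_eq0.
have h0 : h != 0.
  by move: y20; rewrite /y2 mulf_eq0 negb_or => /andP[].
pose p3 := 3%:R * x ^+ 4 + 6%:R * b * x ^+ 2 - b ^+ 2.
have x2x : x2 - x = - p3 / (4%:R * y ^+ 2).
  by rewrite /x2 /p3 yE; field; rewrite four q0.
have p30 : p3 != 0.
  apply: contra x20 => /eqP p30; rewrite eq_sym -subr_eq0 x2x p30.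
  by rewrite oppr0 mul0r.
have -> : ((y2 - y) / (x2 - x)) ^+ 2 =
    (h - 8%:R * (x ^+ 3 + b * x) ^+ 2) ^+ 2
    / (4%:R * p3 ^+ 2 * (x ^+ 3 + b * x)).
  by rewrite x2x -yE /y2; field; rewrite ?(oppr_eq0, two, four, eight, p30, y0).
have -> : ((3%:R * x2 ^+ 2 + b) / (2%:R * y2)) ^+ 2 =
    (3%:R * x2 ^+ 2 + b) ^+ 2 * (16%:R * (x ^+ 3 + b * x) ^+ 3) / h ^+ 2.
  by rewrite -yE /y2; field; rewrite ?(two, four, eight, h0, y0).
move=> E; rewrite /root; move: E; rewrite /x2 yE => /eqP E.
(* The long factor is the abscissa of 4 P minus that of 3 P, which vanishes by [E]. *)
have -> : (psi7 b).[x] = - (16%:R * (x ^+ 3 + b * x) * h ^+ 2 * p3 ^+ 2) *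
   ((3%:R * ((x ^+ 2 - b) ^+ 2 / (4%:R * (x ^+ 3 + b * x))) ^+ 2 + b) ^+ 2 *
    (16%:R * (x ^+ 3 + b * x) ^+ 3) / h ^+ 2
    - (x ^+ 2 - b) ^+ 2 / (4%:R * (x ^+ 3 + b * x))
    - (x ^+ 2 - b) ^+ 2 / (4%:R * (x ^+ 3 + b * x))
    - ((h - 8%:R * (x ^+ 3 + b * x) ^+ 2) ^+ 2
       / (4%:R * p3 ^+ 2 * (x ^+ 3 + b * x)) - x
       - (x ^+ 2 - b) ^+ 2 / (4%:R * (x ^+ 3 + b * x)))).
  rewrite horner_Poly /=; rewrite /h /p3 in h0 p30 *.
  by field; rewrite ?(q0, h0, p30, two, four).
by rewrite E mulr0.
Qed.

Lemma psi7_neq0 : psi7 b != 0.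
Proof.
apply/eqP => /(congr1 (fun p : {poly F} => p.[0])).
rewrite horner_Poly /= horner0 !(mulr0, add0r) => /eqP.
by rewrite oppr_eq0 expf_eq0 (negPf elliptic_neq0).
Qed.

(** There are at most 24 abscissas, with two opposite ordinates each. *)
Lemma torsion7_bound (s : seq points) : uniq s ->
  (forall P, P \in s -> P <> 0 /\ P *+ 7 = 0) -> (size s <= 48)%N.
Proof.
move=> us s7.
have [sqrt sqrtE] : {sqrt : F -> F & forall c, sqrt c ^+ 2 = c}.
  apply: (@choice F F (fun c y => y ^+ 2 = c)) => c.
  have /closed_rootP[y] : size ('X^2 - c%:P) != 1.
    rewrite size_polyDl size_polyXn // size_polyN size_polyC.
    by case: (_ != 0).
  by rewrite /root !hornerE subr_eq0 => /eqP; exists y.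
pose xs := undup (pmap (omap fst \o val) s).
have xs24 : (size xs <= 24)%N.
  rewrite -ltnS; apply: leq_trans (_ : size (psi7 b) <= 25)%N.
    apply: max_poly_roots; rewrite ?undup_uniq ?psi7_neq0 //.
    apply/allP => x; rewrite mem_undup mem_pmap => /mapP[P /s7[_ P7]] /=.
    by case PE: (val P) => [[x1 y1]|] //= [->]; exact: psi7_torsion PE P7.
  exact: size_Poly.
pose pts :=
  [seq Some (x, e * sqrt (x ^+ 3 + b * x)) | x <- xs, e <- [:: 1; -1]].
have <- : size [seq val P | P <- s] = size s by rewrite size_map.
apply: leq_trans (_ : size pts <= _)%N; last first.
  by rewrite size_allpairs; apply: (leq_mul xs24 (leqnn 2)).
apply: uniq_leq_size; first by rewrite map_inj_uniq //; exact: val_inj.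
move=> _ /mapP[P Ps ->]; have [P0 P7] := s7 P Ps.
case PE: (val P) => [[x y]|]; last by case: P0; apply: val_inj.
have xE : x \in xs.
  by rewrite mem_undup mem_pmap; apply/mapP; exists P; rewrite //= PE.
have /eqP yE : y ^+ 2 == sqrt (x ^+ 3 + b * x) ^+ 2.
  by rewrite sqrtE; have := valP P; rewrite PE /= addr0.
apply/allpairsP; move/eqP: yE; rewrite eqf_sqr => /orP[] /eqP ->.
  by exists (x, 1); rewrite xE !inE mul1r eqxx.
by exists (x, -1); rewrite xE !inE mulN1r eqxx orbT.
Qed.

End DivisionPolynomial.

(** * Complex multiplication by i *)

Section ComplexMultiplication.
Variables (F : fieldType) (b i : F).
Hypothesis two : 2%:R != 0 :> F.
Hypothesis i2 : i ^+ 2 = -1.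

Definition ec_i (P : option (F * F)) : option (F * F) :=
  omap (fun p => (- p.1, i * p.2)) P.

Lemma ec_i_curve P : on_curve b 0 P -> on_curve b 0 (ec_i P).
Proof.
case: P => [[x y]|] //= /eqP E; apply/eqP.
by rewrite exprMn i2 E; ring.
Qed.

Lemma ec_iK P : ec_i (ec_i P) = ec_opp P.
Proof.
by case: P => [[x y]|] //=; rewrite opprK mulrA -expr2 i2 mulN1r.
Qed.

Lemma ec_iN P : ec_i (ec_opp P) = ec_opp (ec_i P).
Proof. by case: P => [[x y]|] //=; rewrite mulrN. Qed.

(** Multiplication by i turns a line of slope l into one of slope - i l, hence respects chords and
    tangents. *)
Lemma ec_iD P Q : on_curve b 0 P -> on_curve b 0 Q ->
  ec_i (ec_add b P Q) = ec_add b (ec_i P) (ec_i Q).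
Proof.
have i0 : i != 0.
  by apply: contra_eqN i2 => /eqP ->; rewrite expr0n eq_sym oppr_eq0 oner_neq0.
move=> cP cQ; case: (ec_addP two cP cQ).
- by move->.
- by move->; rewrite ec_add0.
- by move->; rewrite ec_iN ec_addN.
move=> x1 y1 x2 y2 l -> -> n12 [E1 E2].
have sl : is_slope b (- x1) (i * y1) (- x2) (i * y2) (- i * l).
  split; first by rewrite -mulrBr E1; ring.
  transitivity (- i ^+ 2 * (l * (y1 + y2))); first by ring.
  by rewrite i2 E2; ring.
have /= -> := ec_addE two sl.
  congr (Some (_, _)); rewrite exprMn sqrrN i2; first by ring.
  by ring.
move=> /= [/oppr_inj x12]; rewrite -mulrN => /(mulfI i0) y12.
by apply: n12; rewrite /= x12 y12.
Qed.

End ComplexMultiplication.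

Section GaussianPoints.
Variables (F : closedFieldType) (b i : F) (ell : is_elliptic b 0).
Hypothesis i2 : i ^+ 2 = -1.
Local Notation points := (ec_points ell).

Definition points_i (P : points) : points :=
  Sub (ec_i i (val P)) (ec_i_curve i2 (valP P)).

Fact points_i_zmod_morphism : zmod_morphism points_i.
Proof.
move=> P Q; apply: val_inj.
apply: etrans (ec_iD (ec_elliptic ell).1 i2 (valP P) (ec_opp_curve (valP Q))) _.
rewrite val_pointsD val_pointsN; congr (ec_add b _ _).
exact: ec_iN.
Qed.

HB.instance Definition _ :=
  GRing.isZmodMorphism.Build points points points_i points_i_zmod_morphism.

Lemma points_iK (P : points) : points_i (points_i P) = - P.
Proof. by apply: val_inj; exact: (ec_iK i2). Qed.

End GaussianPoints.

(** * The semilinear group of [F_49] *)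

(* The pair [(c, u)] stands for the map [x |-> g ^ c * x ^ (7 ^ u)] of       *)
(* [F_49], with [g] a generator of the unit group.                           *)
Definition semilin49 : Type := ('Z_48 * bool)%type.

HB.instance Definition _ := Finite.on semilin49.

Definition frob7 (u : bool) (c : 'Z_48) : 'Z_48 := if u then 7%:R * c else c.

Lemma frob7D u c d : frob7 u (c + d) = frob7 u c + frob7 u d.
Proof. by case: u => //=; rewrite mulrDr. Qed.

Lemma frob7_comp u v c : frob7 u (frob7 v c) = frob7 (u (+) v) c.
Proof.
case: u v => [] [] //=; rewrite mulrA (_ : 7%:R * 7%:R = 1) ?mul1r //.
exact: val_inj.
Qed.

(** Composition of the maps, [s] after [t]. *)
Definition semilin_mul (s t : semilin49) : semilin49 :=
  (s.1 + frob7 s.2 t.1, s.2 (+) t.2).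
Definition semilin_one : semilin49 := (0, false).
Definition semilin_inv (s : semilin49) : semilin49 := (- frob7 s.2 s.1, s.2).

Fact semilin_mulA : associative semilin_mul.
Proof.
move=> s t r; congr (_, _); rewrite /= ?addbA //.
by rewrite frob7D frob7_comp addrA.
Qed.

Fact semilin_mul1 : left_id semilin_one semilin_mul.
Proof. by case=> c u; rewrite /semilin_mul /= add0r. Qed.

Fact semilin_mulV : left_inverse semilin_one semilin_inv semilin_mul.
Proof.
by case=> c u; rewrite /semilin_mul /= addNr addbb.
Qed.

HB.instance Definition _ := Finite_isGroup.Build semilin49
  semilin_mulA semilin_mul1 semilin_mulV.

Lemma semilinM (s t : semilin49) :
  (s * t)%g = (s.1 + frob7 s.2 t.1, s.2 (+) t.2).
Proof. by []. Qed.

Section SemilinearGroup.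
Local Open Scope group_scope.

Lemma homg_Q16 (gT : finGroupType) (x y : gT) :
  x ^+ 8 = 1 -> y ^+ 2 = x ^+ 4 -> x ^ y = x^-1 -> <[x]> <*> <[y]> \homg 'Q_16.
Proof.
move=> x8 y2 xy; rewrite (Grp_quaternion (n := 4)) //.
by apply/existsP; exists (x, y); rewrite /= !xpair_eqE !eqxx x8 y2 xy !eqxx.
Qed.

Lemma semilin_gen (s : semilin49) :
  s = ((1%R, false) : semilin49) ^+ s.1 * ((0%R, true) : semilin49) ^+ s.2.
Proof.
have gX k : ((1%R, false) : semilin49) ^+ k = (k%:R%R, false).
  by elim: k => // k IHk; rewrite expgSr IHk semilinM mulrSr.
case: s => c u; rewrite gX semilinM /=.
by case: u; rewrite /= addr0 natr_Zp.
Qed.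

(** The norm 5 of g has order 6 modulo 7, so 5 ^ c = (-1) ^ u means c = 3 u modulo 6, whence [x] and
    [y]. As 7 * 16 = 16 modulo 48, g ^ 16 commutes with the Frobenius, and their product [z] has
    order 6. *)
Lemma semilin_sdprod : is_sdprod_Q16_Z6 [set: semilin49]%G.
Proof.
pose x : semilin49 := (6%:R%R, false); pose y : semilin49 := (3%:R%R, true).
pose z : semilin49 := (16%:R%R, true).
have x8 : x ^+ 8 = 1 by apply/eqP; vm_compute.
have y2 : y ^+ 2 = x ^+ 4 by apply/eqP; vm_compute.
have xy : x ^ y = x^-1 by apply/eqP; vm_compute.
have z6 : z ^+ 6 = 1 by apply/eqP; vm_compute.
have xz : x ^ z = x^-1 by apply/eqP; vm_compute.
have yz : y ^ z = x ^+ 3 * y by apply/eqP; vm_compute.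
(* Modulo 48, -18 + 3 + 7 * 16 = 1, so [x ^- 3 * y * z] is g, while [z ^+ 3] is the Frobenius. *)
have gen (s : semilin49) : s = (x ^- 3 * y * z) ^+ s.1 * (z ^+ 3) ^+ s.2.
  rewrite {1}(semilin_gen s); congr (_ ^+ _ * _ ^+ _).
    by apply/eqP; vm_compute.
  by apply/eqP; vm_compute.
move: x y z x8 y2 xy z6 xz yz gen => x y z x8 y2 xy z6 xz yz gen.
pose Q := (<[x]> <*> <[y]>)%G; pose C := <[z]>%G.
have xQ : x \in Q by rewrite mem_gen // inE cycle_id.
have yQ : y \in Q by rewrite mem_gen // inE cycle_id orbT.
have zC : z \in C by exact: cycle_id.
have nQC : C \subset 'N(Q).
  rewrite cycle_subG inE conjYg join_subG -!cycleJ !cycle_subG xz yz.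
  by rewrite groupV xQ groupM ?groupX.
have QC : Q * C = [set: semilin49].
  rewrite -norm_joinEr //; apply/eqP; rewrite eqEsubset subsetT /=.
  have zQC : z \in Q <*> C by rewrite mem_gen // inE zC orbT.
  have sQ : Q \subset Q <*> C by rewrite joing_subl.
  apply/subsetP => s _; rewrite (gen s).
  by rewrite groupM ?groupX // !groupM ?groupV ?groupX // (subsetP sQ).
have Qhom : Q \homg 'Q_16.
  exact: homg_Q16.
have oQ16 : #|'Q_16| = 16 by exact: (@card_quaternion 4).
have oQ : (#|Q| <= 16)%N by have := leq_homg Qhom; rewrite oQ16.
have oC : (#|C| <= 6)%N.
  by apply: dvdn_leq; rewrite // -/(order z) order_dvdn z6.
have oG : #|[set: semilin49]| = 96.
  by rewrite cardsT card_prod card_bool card_ord.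
(* |Q| |C| is 96 times the order of the intersection, so the bounds 16 and 6 are attained and the
   intersection is trivial. *)
have := mul_cardG Q C; rewrite QC oG => oQC.
have I1 : (0 < #|Q :&: C|)%N by rewrite cardG_gt0.
have [oQ' oC' oI] : [/\ #|Q| = 16, #|C| = 6 & #|Q :&: C| = 1%N] by split; nia.
exists Q, C; split.
- by rewrite sdprodE // (card1_trivg oI).
- by rewrite isogEcard Qhom oQ16 oQ'.
- rewrite (isog_cyclic_card _ (cycle_cyclic z)) cardsT card_ord oC' andbT.
  by apply/cyclicP; exists Zp1; exact: Zp_cycle.
Qed.

End SemilinearGroup.

(** * Field extensions *)

Section Extensions.
Variables (K L : fieldType) (f : {rmorphism K -> L}).

(** Factors X are removed from an annihilating polynomial until its constant term c is nonzero; then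
    u p(u) = - c exhibits the inverse. *)
Lemma algebraic_inv_horner (u : L) : algebraicOver f u -> u != 0 ->
  exists q : {poly K}, u^-1 = (map_poly f q).[u].
Proof.
case=> p p0 rp u0; elim/poly_ind: p p0 rp => [|p c IHp]; first by rewrite eqxx.
rewrite /root rmorphD rmorphM /= map_polyX map_polyC /= !hornerE.
have [-> pc0|c0 _ /eqP E] := eqVneq c 0.
  rewrite rmorph0 addr0 mulf_eq0 (negPf u0) orbF; apply: IHp.
  by apply: contra pc0 => /eqP ->; rewrite mul0r add0r polyC0.
exists (- c^-1 *: p); rewrite map_polyZ /= hornerZ rmorphN fmorphV mulNr.
have fc : f c != 0 by rewrite fmorph_eq0.
apply: (mulIf u0); rewrite mulVf // mulNr -mulrA.
by rewrite (canRL (addrK _) E) sub0r mulrN opprK mulVf.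
Qed.

(** Expressing [e] through [s] and [s] through [e] gives matrices with MA MB = 1, whence the
    inequality; if they are square then MB MA = 1 too, and [s] is free. *)
Lemma ext_degree_span n (I : finType) (s : I -> L) : ext_degree f n ->
  (forall x, exists c : I -> K, x = \sum_i f (c i) * s i) ->
  (n <= #|I|)%N /\
  (n = #|I| -> forall c : I -> K,
    \sum_i f (c i) * s i = 0 -> forall i, c i = 0).
Proof.
move=> [e eP] span.
pose lc (c : 'rV[K]_n) := \sum_(i < n) f (c 0 i) * e i.
have lc_inj : injective lc.
  by move=> c d E; have [r [_ rU]] := eP (lc c); rewrite -(rU c) // -(rU d).
pose ls (d : 'rV[K]_#|I|) := \sum_(j < #|I|) f (d 0 j) * s (enum_val j).
have lsE c : \sum_i f (c i) * s i = ls (\row_j c (enum_val j)).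
  rewrite /ls (reindex (fun j : 'I_#|I| => enum_val j)) /=; last first.
    by exists enum_rank => j _; rewrite ?enum_valK ?enum_rankK.
  by apply: eq_bigr => j _; rewrite mxE.
have [A AE] : {A : 'I_n -> 'rV[K]_#|I| & forall i, e i = ls (A i)}.
  apply: (@choice _ _ (fun i r => e i = ls r)) => i.
  by have [c ->] := span (e i); rewrite lsE; eexists.
have [B BE] : {B : 'I_#|I| -> 'rV[K]_n & forall j, s (enum_val j) = lc (B j)}.
  apply: (@choice _ _ (fun j r => s (enum_val j) = lc r)) => j.
  by have [c [cE _]] := eP (s (enum_val j)); exists c.
pose MA := \matrix_i A i; pose MB := \matrix_j B j.
have lcM d : lc (d *m MB) = ls d.
  rewrite /ls; under [RHS]eq_bigr => j _ do rewrite BE mulr_sumr.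
  rewrite exchange_big /=; apply: eq_bigr => i _.
  rewrite mxE rmorph_sum mulr_suml; apply: eq_bigr => j _.
  by rewrite rmorphM mulrA mxE.
have AB : MA *m MB = 1%:M.
  apply/row_matrixP => i; apply: lc_inj.
  rewrite row_mul rowK lcM -AE row1 /lc (bigD1 i) //= mxE !eqxx rmorph1 mul1r.
  by rewrite big1 ?addr0 // => k ki; rewrite mxE (negPf ki) andbF rmorph0 mul0r.
split=> [|nI c]; first exact: mulmx1_min AB.
rewrite lsE; set d := \row_j _ => d0 i.
suff /rowP/(_ (enum_rank i)) : d = 0 by rewrite !mxE enum_rankK.
have : lc (d *m MB) = lc 0.
  by rewrite lcM d0 /lc big1 // => k _; rewrite mxE rmorph0 mul0r.
move/lc_inj; move: {lsE lcM eP} d {d0} => d.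
move: MA MB AB d; rewrite -nI.
move=> MA MB /mulmx1C BA d /(congr1 (mulmx^~ MA)).
by rewrite mul0mx -mulmxA BA mulmx1.
Qed.

End Extensions.

Section Adjoin.
Variables (K L : fieldType) (iota : {rmorphism K -> L}) (S : L -> Prop).

Lemma adjoin_ind (A : {pred adjoin_field iota S}) : divring_closed A ->
  (forall a, adjoin_in iota S a \in A) -> (forall u, S (val u) -> u \in A) ->
  forall u, u \in A.
Proof.
move=> [A1 AB AV] AK AS u.
pose inB x := exists2 v : adjoin_field iota S, val v = x & v \in A.
pose B : {pred L} := fun x => `[< inB x >].
have BP x : reflect (inB x) (x \in B) by exact: asboolP.
have /asboolP/(_ B) uB : val u \in adjoin iota S by exact: adjoin_valP.
suff /BP[v /val_inj <-] : val u \in B by [].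
apply: uB.
- split=> [|x y /BP[v <- vA] /BP[w <- wA]|x y /BP[v <- vA] /BP[w <- wA]];
    apply/BP.
  + by exists 1.
  + by exists (v - w); rewrite ?AB.
  + by exists (v / w); rewrite ?AV // rmorphM fmorphV.
- by move=> a; apply/BP; exists (adjoin_in iota S a).
- move=> s Ss; have sA : s \in adjoin iota S.
    by apply/asboolP => F _ _; apply.
  by apply/BP; exists (AdjoinField sA) => //; apply: AS.
Qed.

End Adjoin.

(** * Automorphisms of an extension of maximal degree *)

(* In degree [4 * deg psi], the field [L = K(x, y, i)] is                     *)
(* [K[X, Y, I] / (psi X, Y^2 - q X, I^2 + 1)], so that every triple satisfying*)
(* the three relations is the image of [(x, y, i)] under an automorphism.    *)
Section Specialisation.
Variables (K L : fieldType) (f : {rmorphism K -> L}) (psi q : {poly K}).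

Definition generates (x y i : L) := forall A : {pred L}, divring_closed A ->
  (forall a, f a \in A) -> x \in A -> y \in A -> i \in A -> forall u, u \in A.

Definition relations (x y i : L) :=
  [/\ (map_poly f psi).[x] = 0, y ^+ 2 = (map_poly f q).[x] & i ^+ 2 = -1].

(* [p a c] is the coefficient of [y ^ a * i ^ c]. *)
Let ev (x y i : L) (p : bool -> bool -> {poly K}) : L :=
  let h r := (map_poly f r).[x] in
  h (p false false) + h (p true false) * y
  + (h (p false true) + h (p true true) * y) * i.

(** The product of two representatives, reduced by Y^2 = q and I^2 = -1. *)
Let mul (p r : bool -> bool -> {poly K}) (a c : bool) : {poly K} :=
  let: (p0, p1, p2, p3) :=
    (p false false, p true false, p false true, p true true) in
  let: (r0, r1, r2, r3) :=
    (r false false, r true false, r false true, r true true) in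
  match a, c with
  | false, false => p0 * r0 + p1 * r1 * q - p2 * r2 - p3 * r3 * q
  | true, false => p0 * r1 + p1 * r0 - p2 * r3 - p3 * r2
  | false, true => p0 * r2 + p2 * r0 + (p1 * r3 + p3 * r1) * q
  | true, true => p0 * r3 + p3 * r0 + p1 * r2 + p2 * r1
  end.

Let ev_sub x y i p r :
  ev x y i (fun a c => p a c - r a c) = ev x y i p - ev x y i r.
Proof. by rewrite /ev /= !rmorphB !hornerE; ring. Qed.

Let ev_mul x y i p r : relations x y i ->
  ev x y i (mul p r) = ev x y i p * ev x y i r.
Proof.
move=> [_ y2 i2].
rewrite /ev /= !(rmorphB, rmorphD, rmorphM) !hornerE -y2.
by ring: i2.
Qed.

Variables (x y i x' y' i' : L).
Hypothesis alg : forall u, algebraicOver f u.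
Hypotheses (rel : relations x y i) (rel' : relations x' y' i').
Hypotheses (gen : generates x y i) (gen' : generates x' y' i').

(** The graph of the automorphism sought: one expression evaluated at both triples. *)
Let Z u v := exists p, u = ev x y i p /\ v = ev x' y' i' p.

Let ZB u v u' v' : Z u v -> Z u' v' -> Z (u - u') (v - v').
Proof.
move=> [p [-> ->]] [p' [-> ->]]; exists (fun a c => p a c - p' a c).
by rewrite !ev_sub.
Qed.

Let ZM u v u' v' : Z u v -> Z u' v' -> Z (u * u') (v * v').
Proof.
by move=> [p [-> ->]] [p' [-> ->]]; exists (mul p p'); rewrite !ev_mul.
Qed.

Let ZP (p : {poly K}) : Z (map_poly f p).[x] (map_poly f p).[x'].
Proof.
exists (fun a c => if a || c then 0 else p).
by rewrite /ev /= rmorph0 !hornerE ?(mul0r, addr0).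
Qed.

Let Zf a : Z (f a) (f a).
Proof. by have := ZP a%:P; rewrite map_polyC !hornerC. Qed.

Let Zx : Z x x'.
Proof. by have := ZP 'X; rewrite map_polyX !hornerX. Qed.

Let Zy : Z y y'.
Proof.
exists (fun a c => (a && ~~ c)%:R).
by rewrite /ev /= rmorph0 rmorph1 !hornerE ?(mul0r, mul1r, addr0, add0r).
Qed.

Let Zi : Z i i'.
Proof.
exists (fun a c => (~~ a && c)%:R).
by rewrite /ev /= rmorph0 rmorph1 !hornerE ?(mul0r, mul1r, addr0, add0r).
Qed.

Let ZD u v u' v' : Z u v -> Z u' v' -> Z (u + u') (v + v').
Proof.
move=> uv uv'; have := ZB uv (ZB (Zf 0) uv').
by rewrite !rmorph0 !sub0r !opprK.
Qed.

Let Zhorner u v (p : {poly K}) :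
  Z u v -> Z (map_poly f p).[u] (map_poly f p).[v].
Proof.
move=> uv; elim/poly_ind: p => [|p c IHp].
  by have := Zf 0; rewrite !rmorph0 !horner0.
rewrite rmorphD rmorphM /= map_polyX map_polyC !hornerE.
exact: ZD (ZM IHp uv) (Zf c).
Qed.

(** The domain of [Z] is a subfield containing the generators; it has inverses because that of an
    algebraic element is a polynomial in it. *)
Let Ztotal u : exists v, Z u v.
Proof.
pose A : {pred L} := fun u => `[< exists v, Z u v >].
have AP u1 : reflect (exists v, Z u1 v) (u1 \in A) by exact: asboolP.
apply/AP/gen.
- split=> [|u1 u2 /AP[v1 Z1] /AP[v2 Z2]|u1 u2 /AP[v1 Z1] /AP[v2 Z2]]; apply/AP.
  + by exists (f 1); rewrite -(rmorph1 f).
  + by exists (v1 - v2); exact: ZB.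
  + have [->|u20] := eqVneq u2 0.
      by exists (f 0); rewrite invr0 mulr0 -(rmorph0 f).
    have [p ->] := algebraic_inv_horner (alg u2) u20.
    by exists (v1 * (map_poly f p).[v2]); apply: ZM => //; exact: Zhorner.
- by move=> a; apply/AP; exists (f a).
- by apply/AP; exists x'.
- by apply/AP; exists y'.
- by apply/AP; exists i'.
Qed.

Variable d : nat.
Hypotheses (size_psi : size psi = d.+1) (deg : ext_degree f (d * 4)).

Let ev_mod x1 y1 i1 p : relations x1 y1 i1 ->
  ev x1 y1 i1 p = ev x1 y1 i1 (fun a c => p a c %% psi).
Proof.
move=> [r _ _].
have E s : (map_poly f s).[x1] = (map_poly f (s %% psi)).[x1].
  by rewrite {1}(divp_eq s psi) rmorphD rmorphM /= !hornerE r mulr0 add0r.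
by rewrite /ev -!E.
Qed.

Let mon (k : 'I_d * (bool * bool)) : L :=
  x ^+ k.1 * (if k.2.1 then y else 1) * (if k.2.2 then i else 1).

Let ev_mon (p : bool -> bool -> {poly K}) :
  (forall a c, (size (p a c) <= d)%N) ->
  ev x y i p = \sum_(k : 'I_d * (bool * bool)) f ((p k.2.1 k.2.2)`_k.1) * mon k.
Proof.
move=> sp; rewrite /mon.
rewrite -(pair_bigA _ (fun (k1 : 'I_d) (k2 : bool * bool) => f (p k2.1 k2.2)`_k1
   * (x ^+ k1 * (if k2.1 then y else 1) * (if k2.2 then i else 1)))) /=.
have E a c : (map_poly f (p a c)).[x] = \sum_(k < d) f (p a c)`_k * x ^+ k.
  rewrite (@horner_coef_wide _ d) ?size_map_poly //.
  by apply: eq_bigr => k _; rewrite coef_map.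
rewrite /ev !E !(mulr_suml, mulrDl) -!big_split /=.
apply: eq_bigr => k _.
rewrite -(pair_bigA _ (fun a c => f (p a c)`_k *
   (x ^+ k * (if a then y else 1) * (if c then i else 1)))) /=.
by rewrite !big_bool /=; ring.
Qed.

Let mod_small (p : {poly K}) : (size (p %% psi)%R <= d)%N.
Proof.
have psi0 : psi != 0 by rewrite -size_poly_gt0 size_psi.
by rewrite -ltnS -size_psi ltn_modp.
Qed.

(** Modulo [psi], expressions are combinations of the 4 d monomials [mon]. These span a space of
    dimension 4 d, hence are free, so a reduced expression with value 0 is zero. *)
Let Zfun0 v : Z 0 v -> v = 0.
Proof.
move=> [p [E ->]]; move: E; rewrite (ev_mod _ rel) (ev_mod _ rel') => E.
have [|_ free] := ext_degree_span deg (s := mon).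
  move=> u; have [v1 [p1 [-> _]]] := Ztotal u.
  by rewrite (ev_mod _ rel) ev_mon; [eexists | move=> *; exact: mod_small].
rewrite ev_mon in E; last by move=> *; exact: mod_small.
have p0 a c : p a c %% psi = 0.
  apply/polyP => k; rewrite coef0; case: (ltnP k d) => [kd|dk]; last first.
    by rewrite nth_default // (leq_trans (mod_small _)).
  have cI : (d * 4)%N = #|{: 'I_d * (bool * bool)}|.
    by rewrite !card_prod card_ord card_bool.
  exact: free cI _ (esym E) (Ordinal kd, (a, c)).
by rewrite /ev !p0 rmorph0 !hornerE ?(mul0r, addr0).
Qed.

Lemma specialisation : exists g : gal f, [/\ g x = x', g y = y' & g i = i'].
Proof.
have Zfun u v v' : Z u v -> Z u v' -> v = v'.
  move=> Z1 Z2; apply/eqP; rewrite -subr_eq0; apply/eqP/Zfun0.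
  by rewrite -(subrr u); exact: ZB.
have [g gZ] := choice Ztotal.
have gB : zmod_morphism g.
  by move=> u v; apply: Zfun (gZ _) _; exact: ZB.
have gM : GRing.monoid_morphism g.
  split=> [|u v]; apply: Zfun (gZ _) _; last exact: ZM.
  by rewrite -{1}(rmorph1 f) -(rmorph1 f).
pose h : {rmorphism L -> L} := HB.pack g (GRing.isZmodMorphism.Build L L g gB)
  (GRing.isMonoidMorphism.Build L L g gM).
have hx : h x = x' by apply: Zfun (gZ _) Zx.
have hy : h y = y' by apply: Zfun (gZ _) Zy.
have hi : h i = i' by apply: Zfun (gZ _) Zi.
have hf a : h (f a) = f a by apply: Zfun (gZ _) (Zf a).
(* The image is a subfield containing the second generating triple. *)
have hsurj v : exists u, h u = v.
  pose A : {pred L} := fun v => `[< exists u, h u = v >].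
  have AP v1 : reflect (exists u, h u = v1) (v1 \in A) by exact: asboolP.
  apply/AP/gen'.
  - split=> [|_ _ /AP[u1 <-] /AP[u2 <-]|_ _ /AP[u1 <-] /AP[u2 <-]]; apply/AP.
    + by exists 1; rewrite rmorph1.
    + by exists (u1 - u2); rewrite rmorphB.
    + by exists (u1 / u2); rewrite rmorphM fmorphV.
  - by move=> a; apply/AP; exists (f a).
  - by apply/AP; exists x.
  - by apply/AP; exists y.
  - by apply/AP; exists i.
have hbij : bijective h.
  have [k hk] := choice hsurj; exists k => // u.
  by apply: (fmorph_inj h); rewrite hk.
by exists (Gal hbij hf).
Qed.

End Specialisation.

(** * The Galois action on the 7-torsion *)

(** Multiplication by 2 + i on coordinates, available over a field that need not be closed and
    transported by field morphisms. *)
Definition ec_gauss (F : fieldType) (a i : F) (P : option (F * F)) :=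
  ec_add a (ec_add a P P) (ec_i i P).

Lemma ec_opp_i (F : fieldType) (i : F) P : ec_opp (ec_i i P) = ec_i (- i) P.
Proof. by case: P => [[x y]|] //=; rewrite mulNr. Qed.

Section PointMap.
Variables (F F' : fieldType) (f : {rmorphism F -> F'}).

Definition ec_map (P : option (F * F)) : option (F' * F') :=
  omap (fun p => (f p.1, f p.2)) P.

Lemma ec_map_inj : injective ec_map.
Proof.
case=> [[x y]|] [[x' y']|] //= [/fmorph_inj -> /fmorph_inj ->]; exact: erefl.
Qed.

Lemma ec_map_add a P Q :
  ec_map (ec_add a P Q) = ec_add (f a) (ec_map P) (ec_map Q).
Proof.
case: P Q => [[x y]|] [[x' y']|] //=; rewrite -rmorphN !fmorph_eq.
case: ifP => // _; rewrite /ec_map [omap _ _]/=; congr (Some (_, _));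
  case: ifP => _;
  by rewrite !(rmorph_nat, rmorphXn, rmorphB, rmorphM, fmorphV, rmorphD).
Qed.

Lemma ec_map_muln a n P : ec_map (ec_muln a n P) = ec_muln (f a) n (ec_map P).
Proof. by elim: n => //= n IHn; rewrite ec_map_add IHn. Qed.

Lemma ec_map_i i P : ec_map (ec_i i P) = ec_i (f i) (ec_map P).
Proof. by case: P => [[x y]|] //=; rewrite rmorphN rmorphM. Qed.

Lemma ec_map_gauss a i P :
  ec_map (ec_gauss a i P) = ec_gauss (f a) (f i) (ec_map P).
Proof. by rewrite /ec_gauss !ec_map_add ec_map_i. Qed.

Lemma ec_map_curve a b P : on_curve (f a) (f b) (ec_map P) = on_curve a b P.
Proof.
by case: P => [[x y]|] //=; rewrite -!(rmorphXn, rmorphM, rmorphD) fmorph_eq.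
Qed.

Lemma ec_map_elliptic a b : is_elliptic (f a) (f b) = is_elliptic a b.
Proof.
rewrite /is_elliptic -(fmorph_eq0 f); congr (~~ (_ == _)).
by rewrite !(rmorph_nat, rmorphXn, rmorphN, rmorphM, rmorphD).
Qed.

End PointMap.

Section TorsionAction.
Variables (K : fieldType) (Kbar : closedFieldType).
Variable iota : {rmorphism K -> Kbar}.
Variables (b : K) (S : Kbar -> Prop).
Hypothesis ell : is_elliptic (iota b) 0.
(** The adjoined set is abstract because the theorem writes it with [iota 0] in place of 0. *)
Hypothesis SE : forall c, S c <-> torsion_coord (iota b) 0 7 c.

Local Notation L := (adjoin_field iota S).
Local Notation inL := (adjoin_in iota S).
Local Notation points := (ec_points ell).
Let bL : L := inL b.
Let vL : {rmorphism L -> Kbar} := \val.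

Definition coord_in (A : {pred L}) (P : option (L * L)) : Prop :=
  if P is Some (x, y) then x \in A /\ y \in A else True.

Lemma torsion_muln (P : points) :
  (P *+ 7 = 0) <-> ec_muln (iota b) 7 (val P) = None.
Proof.
rewrite -val_pointsMn; split=> [->//|E]; exact: val_inj.
Qed.

Lemma torsion_lift (P : points) : P *+ 7 = 0 ->
  exists Q : option (L * L), ec_map vL Q = val P.
Proof.
case PE: (val P) => [[x y]|] P7; last by exists None.
have xy c : c = x \/ c = y -> c \in adjoin iota S.
  move=> cxy; apply/asboolP => A _ _; apply; apply/SE; exists x, y; split=> //.
  by rewrite /is_torsion -PE (valP P) /=; apply/eqP/torsion_muln.
by exists (Some (AdjoinField (xy x (or_introl erefl)),
                 AdjoinField (xy y (or_intror erefl)))).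
Qed.

Variables (iL : L) (p0 : option (L * L)) (P0 : points).
Hypotheses (iL2 : iL ^+ 2 = -1) (p0E : ec_map vL p0 = val P0).
Hypotheses (P0n : P0 <> 0) (P07 : P0 *+ 7 = 0).

Let i2 : vL iL ^+ 2 = -1. Proof. by rewrite -rmorphXn iL2 rmorphN1. Qed.
Let J : {additive points -> points} := @points_i _ _ _ ell i2.
Let JJ : forall P, J (J P) = - P. Proof. exact: points_iK. Qed.

Lemma val_gauss P : val (gauss J P) = ec_gauss (iota b) (vL iL) (val P).
Proof. by rewrite /gauss mulr2n. Qed.

Lemma val_gauss_conj P :
  val (gauss_conj J P) = ec_gauss (iota b) (- vL iL) (val P).
Proof.
rewrite /gauss_conj mulr2n !val_pointsD val_pointsN /ec_gauss.
by congr (ec_add _ _ _); exact: ec_opp_i.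
Qed.

(** (2 + i)^n P0 with coordinates in [L]; n modulo 48 numbers the nonzero 7-torsion points. *)
Definition torsion_pt n : option (L * L) := iter n (ec_gauss bL iL) p0.
Local Notation t := torsion_pt.

Lemma val_torsion_pt n : ec_map vL (t n) = val (iter n (gauss J) P0).
Proof.
elim: n => [|n IHn]; first exact: p0E.
by rewrite /torsion_pt !iterS val_gauss -IHn ec_map_gauss.
Qed.

Lemma torsion_ptD m n : t (m + n) = iter m (ec_gauss bL iL) (t n).
Proof. exact: iterD. Qed.

Lemma torsion_pt_mod n : t n = t (n %% 48).
Proof.
by apply: (@ec_map_inj _ _ vL); rewrite !val_torsion_pt (gauss_mod JJ P07).
Qed.

Lemma torsion_pt_inj m n : (m < 48)%N -> (n < 48)%N -> t m = t n -> m = n.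
Proof.
move=> m48 n48 /(congr1 (ec_map vL)); rewrite !val_torsion_pt => /val_inj.
exact: (gauss_inj JJ P07 P0n).
Qed.

Lemma torsion_pt_conj n : ec_gauss bL (- iL) (t n) = t (7 + n).
Proof.
apply: (@ec_map_inj _ _ vL); rewrite val_torsion_pt iterD.
rewrite (gauss7 JJ (iter_gauss_torsion JJ P07 n)) val_gauss_conj.
by rewrite ec_map_gauss rmorphN val_torsion_pt.
Qed.

Lemma torsion_pt_torsion n :
  [/\ on_curve bL 0 (t n), ec_muln bL 7 (t n) = None & t n <> None].
Proof.
split.
- rewrite -(ec_map_curve vL) rmorph0 val_torsion_pt; exact: valP.
- apply: (@ec_map_inj _ _ vL); rewrite ec_map_muln val_torsion_pt.
  exact/torsion_muln/(iter_gauss_torsion JJ P07).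
move/(congr1 (ec_map vL)); rewrite val_torsion_pt => E.
by apply: (iter_gauss_neq0 JJ P07 P0n (n := n)); apply: val_inj.
Qed.

Lemma torsion_pt_all Q :
  on_curve bL 0 Q -> ec_muln bL 7 Q = None -> Q <> None ->
  exists2 k, (k < 48)%N & Q = t k.
Proof.
move=> cQ Q7 Qn; move: (cQ); rewrite -(ec_map_curve vL) rmorph0 => cQ'.
have := gauss_transitive JJ P07 P0n (@torsion7_bound _ _ ell)
  (w := Sub (ec_map vL Q) cQ' : points).
case.
- by move/(congr1 val) => /= E; apply: Qn; apply: (@ec_map_inj _ _ vL).
- apply/torsion_muln.
  by apply: etrans (esym (ec_map_muln vL bL 7 Q)) _; rewrite Q7.
move=> k k48 /(congr1 val) E; exists k => //.
by apply: (@ec_map_inj _ _ vL); rewrite val_torsion_pt -E.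
Qed.

(** The coordinates of (2 + i)^k P are rational in those of P and i, and these points exhaust the
    nonzero 7-torsion. *)
Lemma torsion_generates (A : {pred L}) n : divring_closed A ->
  (forall a, inL a \in A) -> iL \in A -> coord_in A (t n) -> forall u, u \in A.
Proof.
move=> Aring AK Ai An; have [A1 AB AV] := Aring.
pose A' : divringClosed L := HB.pack A (GRing.isDivringClosed.Build L A Aring).
have coordD P Q : coord_in A' P -> coord_in A' Q -> coord_in A' (ec_add bL P Q).
  case: P Q => [[x y]|] [[x' y']|] // [xA yA] [x'A y'A].
  rewrite /ec_add; case: ifP => // _; cbv zeta.
  set l := (if _ then _ else _).
  have lA : l \in A'.
    rewrite /l; case: ifP => _.
      by rewrite rpred_div ?rpredD ?rpredM ?rpredX ?rpred_nat //; exact: AK.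
    by rewrite rpred_div ?rpredB.
  by split; rewrite ?rpredB ?rpredM ?rpredB ?rpredX.
have coordi P : coord_in A' P -> coord_in A' (ec_i iL P).
  by case: P => [[x y]|] // [xA yA]; split; rewrite ?rpredN ?rpredM.
have coordt k : coord_in A (t (k + n)).
  elim: k => // k IHk; exact: coordD (coordD _ _ IHk IHk) (coordi _ IHk).
apply: adjoin_ind => // u /SE[x [y [/andP[cxy /eqP xy7] uxy]]].
have P7 : (Sub (Some (x, y)) cxy : points) *+ 7 = 0 by exact/torsion_muln.
have [Q QE] := torsion_lift P7; rewrite [RHS]/= in QE.
have [] := @torsion_pt_all Q.
- by rewrite -(ec_map_curve vL) rmorph0 QE.
- apply: (@ec_map_inj _ _ vL); rewrite ec_map_muln QE; exact: xy7.
- by move=> Q0; move: QE; rewrite Q0.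
move=> k k48 Qk; move: QE; rewrite {}Qk {Q}.
(* The orbit is cyclic of length 48, so any [t k] is reached by going forward from [t n]. *)
have -> : t k = t (k + (48 - n %% 48) + n).
  have n48 : (n %% 48 <= 48)%N by rewrite ltnW ?ltn_mod.
  by rewrite [RHS]torsion_pt_mod -modnDmr -addnA subnK // modnDr modn_small.
case: (t _) (coordt (k + (48 - n %% 48))%N) => [[x' y']|] //= [xA yA].
by move=> [xE yE]; case: uxy; rewrite -?xE -?yE => /val_inj ->.
Qed.

Definition acts_as (s : {rmorphism L -> L}) (r : semilin49) :=
  ec_map s p0 = t r.1 /\ s iL = if r.2 then - iL else iL.

(** The image of (2 + i)^n P0 is (2 + s(i))^n s(P0), and 2 - i acts as (2 + i)^7. *)
Lemma acts_as_pt (s : {rmorphism L -> L}) r n : s bL = bL -> acts_as s r ->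
  ec_map s (t n) = t ((if r.2 then 7 * n else n) + r.1).
Proof.
move=> sb [sp si].
have -> : ec_map s (t n) = iter n (ec_gauss bL (s iL)) (t r.1).
  rewrite -sp; elim: n => //= n IHn.
  by rewrite ec_map_gauss sb IHn.
rewrite si; case: r.2; last by rewrite torsion_ptD.
elim: n => // n IHn.
by rewrite iterS IHn torsion_pt_conj; congr t; lia.
Qed.

Lemma acts_as_comp (s s' : {rmorphism L -> L}) r r' : s bL = bL ->
  acts_as s r -> acts_as s' r' -> acts_as (s \o s') (r * r')%g.
Proof.
move=> sb sr [sp' si']; have [sp si] := sr; split; last first.
  rewrite semilinM [LHS]/= si' /=.
  by case: r.2 si => si; case: r'.2; rewrite /= ?rmorphN si ?opprK.
have -> : ec_map (s \o s') p0 = ec_map s (ec_map s' p0) by case: (p0) => [[]|].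
rewrite sp' (acts_as_pt _ sb sr) torsion_pt_mod; congr t.
rewrite semilinM /= addnC; case: r.2 => //=.
by rewrite modnDmr.
Qed.

Lemma iL_neqN : iL <> - iL.
Proof.
move=> /eqP; rewrite -addr_eq0 -mulr2n -mulr_natl mulf_eq0 => /orP[].
  by rewrite -(fmorph_eq0 vL) rmorph_nat (negPf (ec_elliptic ell).1).
move/eqP => i0; move: iL2; rewrite i0 expr0n => /esym/eqP.
by rewrite oppr_eq0 oner_eq0.
Qed.

Lemma acts_as_inj (s : {rmorphism L -> L}) r r' :
  acts_as s r -> acts_as s r' -> r = r'.
Proof.
case: r r' => [c u] [c' u'] [/= sp si]; rewrite /acts_as sp si /= => -[cc' uu'].
congr (_, _).
  by apply/val_inj/(torsion_pt_inj _ _ cc'); exact: ltn_ord.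
by case: u u' uu' {si} => [] [] // => [/esym|] /iL_neqN.
Qed.

Lemma acts_as_ex (s : {rmorphism L -> L}) : s bL = bL -> exists r, acts_as s r.
Proof.
move=> sb; have [c0 m0 n0] := torsion_pt_torsion 0.
have [] := @torsion_pt_all (ec_map s p0).
- by rewrite -sb -(rmorph0 s) ec_map_curve.
- by rewrite -sb -ec_map_muln m0.
- by move=> E; apply: n0; exact: (@ec_map_inj _ _ s).
move=> k k48 E.
have [u uE] : exists u : bool, s iL = if u then - iL else iL.
  have : s iL ^+ 2 == iL ^+ 2 by rewrite -rmorphXn iL2 rmorphN1.
  by rewrite eqf_sqr => /orP[] /eqP ->; [exists false | exists true].
by exists (inZp k, u); split; rewrite //= E [t k]torsion_pt_mod.
Qed.

(** The elements on which [s] and [s'] agree form a subfield containing generators of [L]. *)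
Lemma acts_as_faithful (s s' : {rmorphism L -> L}) r :
  (forall a, s (inL a) = inL a) ->
  (forall a, s' (inL a) = inL a) -> acts_as s r -> acts_as s' r -> s =1 s'.
Proof.
move=> sK s'K [sp si] [s'p s'i] u; apply/eqP.
have [_ _ n0] := torsion_pt_torsion 0.
pose A : {pred L} := fun v => s v == s' v.
apply: (@torsion_generates A 0).
- split=> [|v w /eqP vA /eqP wA|v w /eqP vA /eqP wA]; apply/eqP.
  + by rewrite !rmorph1.
  + by rewrite !rmorphB vA wA.
  + by rewrite !rmorphM !fmorphV vA wA.
- by move=> a; apply/eqP; rewrite sK s'K.
- by apply/eqP; rewrite si s'i.
move: sp; rewrite -s'p -[t 0]/p0; case: (p0) => [[x y]|] //= [xE yE].
by split; apply/eqP.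
Qed.


Lemma torsion_pt_relations n x y (j : L) : t n = Some (x, y) -> j ^+ 2 = -1 ->
  relations inL (psi7 b) ('X^3 + b *: 'X) x y j.
Proof.
move=> tE j2; have [c _ _] := torsion_pt_torsion n; split=> //.
- have tv := val_torsion_pt n; rewrite tE /= in tv.
  have := psi7_torsion (esym tv) (iter_gauss_torsion JJ P07 n).
  rewrite -[iota b]/(vL bL) -(map_psi7 vL) /root horner_map fmorph_eq0.
  by rewrite map_psi7 => /eqP.
move: c; rewrite tE /= addr0 => /eqP ->.
by rewrite rmorphD /= map_polyXn map_polyZ map_polyX !hornerE.
Qed.

Hypothesis alg : is_alg_closure iota.

Lemma adjoin_algebraic (u : L) : algebraicOver inL u.
Proof.
have [p pn0 rp] := alg (vL u); exists p => //; move: rp.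
rewrite /root (_ : map_poly iota p = map_poly vL (map_poly inL p)).
  by rewrite horner_map fmorph_eq0.
by rewrite -map_poly_comp.
Qed.

(** The coordinates of [t 0] with i, and those of [t r.1] with the prescribed root of -1, satisfy
    the same relations and both generate [L]; [specialisation] applies with 96 = 24 * 4. *)
Lemma acts_as_surj (r : semilin49) : ext_degree inL 96 ->
  exists g : gal inL, acts_as g r.
Proof.
move=> deg; pose j := if r.2 then - iL else iL.
have j2 : j ^+ 2 = -1 by rewrite /j; case: r.2; rewrite ?sqrrN.
have coord n : exists x y, t n = Some (x, y).
  have [_ _] := torsion_pt_torsion n.
  by case: (t n) => [[x y]|] // _; exists x, y.
have [x [y xyE]] := coord 0; have [x' [y' xyE']] := coord r.1.
have b0 : iota b != 0 by exact: elliptic_neq0 ell.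
(* In characteristic 7 [psi7] has no root, yet the abscissa of a torsion point is one; so its degree
   is 24. *)
have seven : 7%:R != 0 :> K.
  apply/eqP => c7; have [E _ _] := torsion_pt_relations xyE iL2.
  move: E; rewrite map_psi7 psi7_char7; last first.
    by rewrite -(rmorph_nat inL) c7 rmorph0.
  move/eqP; rewrite oppr_eq0 expf_eq0 fmorph_eq0 /= => /eqP bz.
  by move: b0; rewrite bz rmorph0 eqxx.
have gen n x1 y1 : t n = Some (x1, y1) -> generates inL x1 y1 iL.
  move=> tE A Ar AK Ax Ay Ai.
  by apply: (torsion_generates Ar AK Ai (n := n)); rewrite tE.
have gen' : generates inL x' y' j.
  move=> A Ar AK Ax Ay Aj; apply: (gen _ _ _ xyE') => //; have [A1 AB _] := Ar.
  have A0 : 0 \in A by rewrite -(subrr 1) AB.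
  by move: Aj; rewrite /j; case: r.2 => // /(AB _ _ A0); rewrite sub0r opprK.
have [g [gx gy gi]] := specialisation adjoin_algebraic
  (torsion_pt_relations xyE iL2) (torsion_pt_relations xyE' j2)
  (gen _ _ _ xyE) gen' (size_psi7 b seven) deg.
by exists g; split=> //; rewrite -[p0]/(t 0) xyE xyE' /= gx gy.
Qed.

End TorsionAction.

(** * The representation in the semilinear group *)

Lemma group_iso_image (A : groupType) (gT : finGroupType) (f : A -> gT) :
  {morph f : x y / (x * y)%g} -> injective f ->
  (exists H : {group gT}, group_iso A H) /\
  ((forall y, exists x, f x = y) -> group_iso A [set: gT]%G).
Proof.
move=> fM fI.
pose h : {multiplicative A -> gT} :=
  HB.pack f (isMultiplicative.Build A gT f fM).
split; last first.
  by move=> fS; exists h; split=> // y; rewrite inE; split=> // _; exact: fS.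
pose H := [set y | `[< exists x, f x = y >]].
have HP y : reflect (exists x, f x = y) (y \in H).
  by rewrite inE; exact: asboolP.
have gH : group_set H.
  apply/group_setP; split=> [|_ _ /HP[x <-] /HP[y <-]]; apply/HP.
    exists 1%g; apply: (@mulgI _ (f 1%g)).
    by rewrite -fM !mulg1.
  by exists (x * y)%g.
by exists (Group gH), h; split=> // y; split=> [/HP//|/HP].
Qed.

Lemma torsion7_representation (K : fieldType) (Kbar : closedFieldType)
    (iota : {rmorphism K -> Kbar}) (b : K) (S : Kbar -> Prop)
    (inL : {rmorphism K -> adjoin_field iota S} := adjoin_in iota S) :
  is_alg_closure iota -> is_elliptic (iota b) 0 ->
  (forall c, S c <-> torsion_coord (iota b) 0 7 c) ->
  exists f : gal inL -> semilin49,
    [/\ {morph f : x y / (x * y)%g}, injective f &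
        ext_degree inL 96 -> forall y, exists x, f x = y].
Proof.
move=> alg ell SE.
pose vL : {rmorphism adjoin_field iota S -> Kbar} := \val.
have [[P0 [P0n P07]]|noP] :=
    pselect (exists P : ec_points ell, P <> 0 /\ P *+ 7 = 0); last first.
  (* Without nonzero 7-torsion nothing is adjoined: the group is trivial and the degree cannot be
     96. *)
  have base (u : adjoin_field iota S) : exists a, u = inL a.
    pose A : {pred adjoin_field iota S} := fun u => `[< exists a, u = inL a >].
    have AP u1 : reflect (exists a, u1 = inL a) (u1 \in A) by exact: asboolP.
    apply/AP; apply: (@adjoin_ind _ _ iota S A).
    - split=> [|_ _ /AP[a1 ->] /AP[a2 ->]|_ _ /AP[a1 ->] /AP[a2 ->]]; apply/AP.
      + by exists 1; rewrite rmorph1.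
      + by exists (a1 - a2); rewrite rmorphB.
      + by exists (a1 / a2); rewrite rmorphM fmorphV.
    - by move=> a; apply/AP; exists a.
    - move=> c /SE[x [y [/andP[cxy /eqP xy7] _]]]; case: noP.
      exists (Sub (Some (x, y)) cxy); split; first by move/(congr1 val).
      exact/torsion_muln.
  exists (fun=> 1%g); split.
  - by move=> g h; rewrite mulg1.
  - by move=> g h _; apply: galP => u; have [a ->] := base u; rewrite !gal_fix.
  - move=> deg; have [] := ext_degree_span deg (I := unit) (s := fun=> 1).
      move=> u; have [a ->] := base u; exists (fun=> a).
      by rewrite big_const card_unit /= mulr1 addr0.
    by rewrite card_unit.
have [p0 p0E] := torsion_lift SE P07.
(* The ordinate of i P0 is i times that of P0, which is nonzero since P0 is not 2-torsion; the
   quotient puts i in the torsion field. *)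
have [iL iL2] : exists iL : adjoin_field iota S, iL ^+ 2 = -1.
  have /closed_rootP[i] : size ('X^2 + 1 : {poly Kbar}) != 1.
    by rewrite size_polyDl size_polyXn // size_poly1.
  rewrite /root !hornerE addr_eq0 => /eqP i2.
  have iP7 : points_i i2 P0 *+ 7 = 0 by rewrite -raddfMn P07 raddf0.
  have [Q QE] := torsion_lift SE iP7.
  case P0E: (val P0) => [[x y]|]; last by case: P0n; apply: val_inj.
  have y0 : y != 0.
    apply/eqP => y0; apply: (mulrn_neq0 P07 P0n (k := 2)) => //.
    by apply: val_inj; rewrite mulr2n val_pointsD P0E y0 /= oppr0 !eqxx.
  move: p0E QE; rewrite P0E; case: p0 => [[x0 y0']|] //= [_ y0E].
  rewrite [sval P0]P0E; case: Q => [[x1 y1]|] //= [_ y1E].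
  exists (y1 / y0'); apply: (fmorph_inj vL).
  rewrite rmorphXn fmorph_div rmorphN1 /= y0E y1E.
  by rewrite mulfK.
have spec (g : gal inL) : {r | acts_as b iL p0 g r}.
  apply: cid.
  exact: (acts_as_ex iL2 p0E P0n P07 (s := g) (gal_fix g b)).
exists (fun g => sval (spec g)); split.
- move=> g h; apply: (acts_as_inj iL2 p0E P0n P07 (s := (g * h)%g)
    (svalP (spec (g * h)%g))).
  exact: (acts_as_comp iL2 p0E P07 (s := g) (s' := h) (gal_fix g b)
    (svalP (spec g)) (svalP (spec h))).
- move=> g h E; apply: galP.
  apply: (acts_as_faithful SE iL2 p0E P0n P07 (s := g) (s' := h)
    (gal_fix g) (gal_fix h)).
    exact: svalP (spec g).
  by rewrite E; exact: svalP (spec h).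
- move=> deg r; have [g gr] := acts_as_surj SE iL2 p0E P0n P07 alg r deg.
  by exists g; exact: (acts_as_inj iL2 p0E P0n P07 (s := g) (svalP (spec g))).
Qed.

Theorem theorem3 (K : fieldType) (Kbar : closedFieldType)
    (iota : {rmorphism K -> Kbar}) (b : K) :
  is_alg_closure iota ->
  2%N \notin [pchar K] -> 3%N \notin [pchar K] ->
  is_elliptic b 0 ->
  let K_to_K7 := torsion_field_in iota b 0 7 in
  exists (gT : finGroupType) (G : {group gT}),
    is_sdprod_Q16_Z6 G /\
    (exists H : {group gT}, H \subset G /\ group_iso (gal K_to_K7) H) /\
    (ext_degree K_to_K7 96 -> group_iso (gal K_to_K7) G).
Proof.
move=> alg _ _ ellK inL.
exists semilin49, [set: semilin49]%G; split; first exact: semilin_sdprod.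
have ell : is_elliptic (iota b) 0 by rewrite -(rmorph0 iota) ec_map_elliptic.
have SE c : torsion_coord (iota b) (iota 0) 7 c <->
    torsion_coord (iota b) 0 7 c.
  by rewrite rmorph0.
have [f [fM fI fS]] := torsion7_representation alg ell SE.
have [[H iH] isoT] := group_iso_image fM fI.
by split=> [|/fS/isoT//]; exists H; rewrite subsetT.
Qed.
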